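(* Assume $n=1$, so that $g:\mathbb{C}^2\to\mathbb{C}$ defines a family of plane curves. Then for any $t\in\mathbb{C}$ and any $\lambda$, the classes of those $\widetilde{\omega}_i^j$ for which $\lambda_i^j=\lambda$ induce a basis of $\mathrm{gr}^V_\lambda(G_t/\tau^{-1}G_t)$.
   Context: Setting ($n=1$). Let $\mathcal{O}=\mathbb{C}[x_1,x_2]$, graded by giving $x_i$ a positive rational weight $p_i$; ''homogeneous'' always refers to this grading. Let $g\in\mathcal{O}$ be homogeneous of degree $e$, write $C_t=g^{-1}(t)$, and assume that $C_0$ is a reduced curve which is not smooth. Let $f\in\mathcal{O}$ be homogeneous of degree $1$ and such that $f_0:=f|_{C_0}$ is not constant on any branch of $C_0$. Let $J$ be the Jacobian determinant of $(f,g)$, $I=(g)$, $\mu=\dim_{\mathbb{C}}\mathcal{O}/(I+(J))$. The coordinate on the target of $g$, also denoted $t$, acts on $\mathcal{O}$ as multiplication by $g$. Gauss–Manin system. Let $\alpha=dx_1\wedge dx_2/dg$, let $\omega_g=\mathcal{O}\alpha$ be the relative dualising module of $g$ and $\omega_{C_0}=\omega_g/g\omega_g$. The relative differential $d:\mathcal{O}\to\omega_g$ is $dh=J_h\alpha$, with $J_h$ the Jacobian determinant of $(h,g)$; in particular $df=J\alpha$. Put $$\mathbf{G}:=\frac{\omega_g[\tau,\tau^{-1}]}{(d-\tau\, df\wedge)\mathcal{O}[\tau,\tau^{-1}]},\qquad (df\wedge)h=hJ\alpha,$$ with the operator $\partial_\tau$ determined by $\partial_\tau[\omega]=[-f\omega]$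 for $\omega\in\omega_g$ and the Leibniz rule in $\tau$. Let $G$ be the image of $\omega_g[\tau^{-1}]\to\mathbf{G}$ (the Brieskorn lattice; it is free of rank $\mu$ over $\mathbb{C}[t,\tau^{-1}]$). For a point $t_0\in\mathbb{C}$ put $\mathbf{G}_{t_0}=\mathbf{G}/(t-t_0)\mathbf{G}$ and $G_{t_0}=G/(t-t_0)G$; in the claim the point is denoted $t$. $V$-filtration. The Malgrange–Kashiwara filtration $V_\bullet(\mathbf{G}_t)$ is the unique increasing exhaustive filtration indexed by $\mathbb{Q}$ such that: (1) each $V_\lambda$ is $\mathbb{C}[\tau]$-free and $\mathbb{C}[\tau,\tau^{-1}]\otimes_{\mathbb{C}[\tau]}V_\lambda=\mathbf{G}_t$; (2) $\tau V_\lambda=V_{\lambda-1}$ and $\partial_\tau V_\lambda\subset V_{\lambda+1}$; (3) $\tau\partial_\tau+\lambda$ is nilpotent on $\mathrm{gr}^V_\lambda=V_\lambda/V_{<\lambda}$; (4) there is a finite set $A\subset[0,1)$ such that $V_\lambda=V_{\lambda'}$ where $\lambda'$ is the largest element of $A+\mathbb{Z}$ with $\lambda'\le\lambda$. Define $$\mathrm{gr}^V_\lambda(G_t/\tau^{-1}G_t):=\frac{V_\lambda\cap G_t}{V_\lambda\cap\tau^{-1}G_t+V_{<\lambda}\cap G_t}.$$ Basis. Let $\mu_2=\dim_{\mathbb{C}}\mathcal{O}/(f,g)-1$. Multiplication by $-f_0$ on $\omega_{C_0}/\mathcal{O}_{C_0}df_0\cong\mathcal{O}/(I+(J))$ is nilpotent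 and homogeneous with $\mu_2$-dimensional kernel. Fix a homogeneous Jordan basis: homogeneous $\omega_1^0,\dots,\omega_{\mu_2}^0\in\omega_g$ and integers $N_i\geq0$ such that, with $\omega_i^j:=(-f)^j\omega_i^0\in\omega_g$, the classes of $\omega_i^j$ $(1\le i\le\mu_2,\ 0\le j\le N_i)$ form a basis of $\omega_{C_0}/\mathcal{O}_{C_0}df_0$, and $f\omega_i^{N_i}$ has zero class. For $\omega=h\alpha$ with $h$ homogeneous let $\nu(\omega)=\deg h+p_1+p_2-e$, and $\nu_i^j:=\nu(\omega_i^j)$. One has $\nu_i^0\le1$. Define elements of $G$ (hence, by reduction, of every $G_t$) and numbers $$\widetilde{\omega}_i^j=\begin{cases}[\omega_i^j]+(\nu_i^j-1)\tau^{-1}[\omega_i^{j-1}] & \text{if }\nu_i^j>1,\\ [\omega_i^j] & \text{if }\nu_i^j\leq1,\end{cases}\qquad \lambda_i^j=\begin{cases}1&\text{if }\nu_i^j>1,\\ \nu_i^j&\text{if }0\leq\nu_i^j\leq1,\\ 0&\text{if }\nu_i^j<0.\end{cases}$$ *)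

(* Defs.v *)
From HB Require Import structures.
From mathcomp Require Import all_boot all_order all_algebra ring_quotient.
From mathcomp Require Import boolp classical_sets reals complex.
From mathcomp Require Import finmap monalg.
From mathcomp Require Import mpoly ring.

Set Implicit Arguments.
Unset Strict Implicit.
Unset Printing Implicit Defensive.

Import Order.TTheory GRing.Theory Num.Theory.
Local Open Scope ring_scope.
Local Open Scope classical_set_scope.
Local Open Scope quotient_scope.

Section Coker.
Variables (K : nzRingType) (V : lmodType K) (phi : {linear V -> V}).

Definition limage : {pred V} := fun y => `[< exists x, y = phi x >].

Lemma limageP y : reflect (exists x, y = phi x) (y \in limage).
Proof. exact: asboolP. Qed.

Lemma limage_submod_closed : submod_closed limage.
Proof.
split; first by apply/limageP; exists 0; rewrite linear0.
move=> a _ _ /limageP[x ->] /limageP[y ->]; apply/limageP.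
by exists (a *: x + y); rewrite linearP.
Qed.

HB.instance Definition _ :=
  GRing.isSubmodClosed.Build K V limage limage_submod_closed.

Definition coker := Quotient.quot (limage : zmodClosed V).

HB.instance Definition _ := GRing.Zmodule.on coker.

Definition cokproj (x : V) : coker := \pi x.

Lemma cokproj_eq x y : (cokproj x = cokproj y) <-> (x - y \in limage).
Proof.
by rewrite Quotient.idealrBE; split=> [/eqP|/eqP].
Qed.

Lemma cokproj_surj c : exists x, c = cokproj x.
Proof. by exists (repr c); rewrite /cokproj reprK. Qed.

Lemma cokproj_zmod_morphism : zmod_morphism cokproj.
Proof. by move=> x y; rewrite /cokproj raddfB. Qed.

HB.instance Definition _ :=
  GRing.isZmodMorphism.Build V coker cokproj cokproj_zmod_morphism.

Definition coker_scale (a : K) (c : coker) : coker := cokproj (a *: repr c).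

Lemma coker_scaleE a x : coker_scale a (cokproj x) = cokproj (a *: x).
Proof.
apply/cokproj_eq; rewrite -scalerBr rpredZ //.
by apply/cokproj_eq; rewrite /cokproj reprK.
Qed.

Lemma coker_scaleA a b c :
  coker_scale a (coker_scale b c) = coker_scale (a * b) c.
Proof. by case: (cokproj_surj c) => x ->; rewrite !coker_scaleE scalerA. Qed.

Lemma coker_scale1 : left_id 1 coker_scale.
Proof. by move=> c; case: (cokproj_surj c) => x ->; rewrite coker_scaleE scale1r. Qed.

Lemma coker_scaleDr : right_distributive coker_scale +%R.
Proof.
move=> a c c'; case: (cokproj_surj c) => x ->; case: (cokproj_surj c') => y ->.
by rewrite -raddfD !coker_scaleE scalerDr raddfD.
Qed.

Lemma coker_scaleDl c : {morph coker_scale^~ c : a b / a + b}.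
Proof.
move=> a b; case: (cokproj_surj c) => x ->.
by rewrite !coker_scaleE scalerDl raddfD.
Qed.

HB.instance Definition _ := GRing.Zmodule_isLmodule.Build K coker
  coker_scaleA coker_scale1 coker_scaleDr coker_scaleDl.

Lemma cokproj_scalable : scalable cokproj.
Proof. by move=> a x; rewrite -coker_scaleE. Qed.

HB.instance Definition _ := GRing.isScalable.Build K V coker *:%R cokproj
  cokproj_scalable.

Variables (psi : {linear V -> V}) (comm : forall x, phi (psi x) = psi (phi x)).

Definition cokmap of (forall x, phi (psi x) = psi (phi x)) : coker -> coker :=
  fun c => cokproj (psi (repr c)).

Local Notation cokmap_psi := (cokmap comm).

Lemma cokmapE x : cokmap_psi (cokproj x) = cokproj (psi x).
Proof.
apply/cokproj_eq; rewrite -linearB /=.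
have /cokproj_eq /limageP[y ->] : cokproj (repr (cokproj x)) = cokproj x.
  by rewrite /cokproj reprK.
by apply/limageP; exists (psi y); rewrite comm.
Qed.

Lemma cokmap_linear : linear cokmap_psi.
Proof.
move=> a c c'; case: (cokproj_surj c) => x ->; case: (cokproj_surj c') => y ->.
by rewrite -linearP !cokmapE -linearP; congr cokproj; rewrite linearP.
Qed.

HB.instance Definition _ := GRing.isLinear.Build K coker coker *:%R cokmap_psi
  cokmap_linear.

End Coker.

(* The classes of the b i with P i form a basis of A / (A `&` B). *)
Definition basis_mod (K : nzRingType) (M : lmodType K) (A B : set M)
    (I : finType) (P : pred I) (b : I -> M) : Prop :=
  [/\ forall i, P i -> A (b i),
      forall a, A a -> exists c : I -> K, B (a - \sum_(i | P i) c i *: b i)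
    & forall c : I -> K, B (\sum_(i | P i) c i *: b i) ->
        forall i, P i -> c i = 0].

Section PlaneCurves.
Variable K : fieldType.
Local Notation O := (mpoly 2 K).

Definition wgt (p : 'I_2 -> rat) (m : 'X_{1..2}) : rat := \sum_(i < 2) p i *+ m i.

Definition whomog (p : 'I_2 -> rat) (d : rat) (h : O) : Prop :=
  forall m, m \in msupp h -> wgt p m = d.

(* The degree of a nonzero weighted homogeneous polynomial, read off on one of
   its monomials. *)
Definition wdeg (p : 'I_2 -> rat) (h : O) : rat := wgt p (mlead h).

Definition mdivides (a b : O) : Prop := exists c, b = c * a.

Definition mirreducible (q : O) : Prop :=
  [/\ q != 0, q \isn't a GRing.unit
    & forall a b, q = a * b -> a \is a GRing.unit \/ b \is a GRing.unit].

(* C_0 = g^{-1}(0) is taken as the scheme with coordinate ring O / (g). *)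
Definition reduced_curve (g : O) : Prop :=
  [/\ g != 0, g \isn't a GRing.unit
    & forall (h : O) n, mdivides g (h ^+ n) -> mdivides g h].

Definition smooth_curve (g : O) : Prop :=
  forall x : 'I_2 -> K, g.@[x] = 0 -> exists i, (g^`M(i)).@[x] != 0.

(* Branches are the zero sets of the irreducible factors of g; for a weighted
   homogeneous g (positive weights) these are unibranch at every point, so that
   local analytic branches give the same condition. *)
Definition nonconstant_on_branches (f g : O) : Prop :=
  forall q, mirreducible q -> mdivides q g ->
    ~ exists c : K, forall x : 'I_2 -> K, q.@[x] = 0 -> f.@[x] = c.

Definition ideal2 (a b : O) : set O :=
  [set h | exists u v : O, h = u * a + v * b].

Definition dim_quot (I : set O) (d : nat) : Prop :=
  exists b : 'I_d -> O, basis_mod setT I predT b.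

Definition jac (h k : O) : O :=
  h^`M(ord0) * k^`M(ord_max) - h^`M(ord_max) * k^`M(ord0).

(* The relative differential d : O -> omega_g, where omega_g = O alpha is
   identified with O by h alpha |-> h. *)
Definition rdiff (g h : O) : O := jac h g.

Lemma rdiff_linear g : linear (rdiff g).
Proof.
move=> a u v; rewrite /rdiff /jac !linearP /= !mulrDl -!scalerAl opprD scalerBr.
by rewrite addrACA.
Qed.

HB.instance Definition _ g :=
  GRing.isLinear.Build K O O *:%R (rdiff g) (rdiff_linear g).

Lemma jacMl a h k : jac (a * h) k = a * jac h k + h * jac a k.
Proof.
rewrite /jac !mderivM !mulrDl !mulrBr opprD addrACA addrC.
by congr (_ + _); congr (_ - _); rewrite ?mulrA // [h * _]mulrC.
Qed.

Lemma jacxx k : jac k k = 0.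
Proof. by rewrite /jac mulrC subrr. Qed.

End PlaneCurves.

Section Laurent.
Variable K : fieldType.
Local Notation O := (mpoly 2 K).

(* Through the trivialisation h |-> h alpha of omega_g, this type also stands
   for omega_g[tau, tau^-1]. *)
Definition laurent := malg int O.

HB.instance Definition _ := GRing.Zmodule.on laurent.

Definition lcoef (k : int) (l : laurent) : O := monalg.mcoeff k l.

Definition lmono (k : int) (h : O) : laurent := mkmalgU k h.

Lemma lcoefP (l1 l2 : laurent) : (forall k, lcoef k l1 = lcoef k l2) <-> l1 = l2.
Proof. exact: malgP. Qed.

Lemma lcoef_zmod_morphism k : zmod_morphism (lcoef k).
Proof. by move=> x y; rewrite /lcoef monalg.mcoeffB. Qed.

HB.instance Definition _ k :=
  GRing.isZmodMorphism.Build laurent O (lcoef k) (lcoef_zmod_morphism k).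

Lemma lcoef_mono k j h : lcoef k (lmono j h) = h *+ (j == k).
Proof. by rewrite /lcoef /lmono mcoeffU. Qed.

(* sum_k l_k tau^k |-> sum_k (u k l_k) tau^(k + m) *)
Definition lmap (u : int -> O -> O) (m : int) (l : laurent) : laurent :=
  \sum_(k <- monalg.msupp l) lmono (k + m) (u k (lcoef k l)).

Lemma lcoef_map u m k l : (forall j, u j 0 = 0) ->
  lcoef k (lmap u m l) = u (k - m) (lcoef (k - m) l).
Proof.
move=> u0; rewrite /lmap raddf_sum /=.
have [kl|kl] := boolP (k - m \in monalg.msupp l).
  rewrite (big_fsetD1 _ kl) /= lcoef_mono subrK eqxx mulr1n.
  rewrite big1_fset ?addr0 // => j; rewrite !inE => /andP[jk _] _.
  by rewrite lcoef_mono -(inj_eq (addIr (- m))) addrK (negPf jk).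
rewrite [lcoef (k - m) l]mcoeff_outdom // u0 big1_fset // => j jl _.
rewrite lcoef_mono; case: eqP => // jk.
by move: kl; rewrite -jk addrK jl.
Qed.

Definition lscale (a : K) (l : laurent) : laurent := lmap (fun _ h => a *: h) 0 l.

Lemma lcoefZ_def a k l : lcoef k (lscale a l) = a *: lcoef k l.
Proof. by rewrite lcoef_map ?subr0 // => j; rewrite scaler0. Qed.

Lemma lscaleA a b l : lscale a (lscale b l) = lscale (a * b) l.
Proof. by apply/lcoefP => k; rewrite !lcoefZ_def scalerA. Qed.

Lemma lscale1 : left_id 1 lscale.
Proof. by move=> l; apply/lcoefP => k; rewrite !lcoefZ_def scale1r. Qed.

Lemma lscaleDr : right_distributive lscale +%R.
Proof.
move=> a l l'; apply/lcoefP => k.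
by rewrite lcoefZ_def !(raddfD (lcoef k)) /= !lcoefZ_def scalerDr.
Qed.

Lemma lscaleDl l : {morph lscale^~ l : a b / a + b}.
Proof.
by move=> a b; apply/lcoefP => k; rewrite (raddfD (lcoef k)) /= !lcoefZ_def scalerDl.
Qed.

HB.instance Definition _ := GRing.Zmodule_isLmodule.Build K laurent
  lscaleA lscale1 lscaleDr lscaleDl.

Lemma lcoef_scalable k : scalable (lcoef k).
Proof. by move=> a l; rewrite -lcoefZ_def. Qed.

HB.instance Definition _ k := GRing.isScalable.Build K laurent O *:%R (lcoef k)
  (lcoef_scalable k).

Lemma lmap_linear (u : int -> {linear O -> O}) m : linear (lmap u m).
Proof.
move=> a l l'; apply/lcoefP => k.
by rewrite linearP /= !lcoef_map ?linearP // => j; rewrite linear0.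
Qed.

HB.instance Definition _ (u : int -> {linear O -> O}) m :=
  GRing.isLinear.Build K laurent laurent *:%R (lmap u m) (lmap_linear u m).

Definition ltau (m : int) : {linear laurent -> laurent} :=
  lmap (fun _ => idfun : {linear O -> O}) m.

Lemma lcoef_tau m k l : lcoef k (ltau m l) = lcoef (k - m) l.
Proof. by rewrite lcoef_map. Qed.

Definition lmul (h : O) : {linear laurent -> laurent} :=
  lmap (fun _ => GRing.mull_fun h idfun : {linear O -> O}) 0.

Lemma lcoef_mul h k l : lcoef k (lmul h l) = h * lcoef k l.
Proof. by rewrite lcoef_map ?subr0 // => j; rewrite linear0. Qed.

Definition lrdiff (g : O) : {linear laurent -> laurent} :=
  lmap (fun _ => rdiff g : {linear O -> O}) 0.

Lemma lcoef_rdiff g k l : lcoef k (lrdiff g l) = rdiff g (lcoef k l).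
Proof. by rewrite lcoef_map ?subr0 // => j; rewrite linear0. Qed.

Definition ldtau : {linear laurent -> laurent} :=
  lmap (fun k => k%:~R \*: idfun : {linear O -> O}) (- 1).

Lemma lcoef_dtau k l : lcoef k (ldtau l) = (k + 1)%:~R *: lcoef (k + 1) l.
Proof. by rewrite lcoef_map ?opprK // => j; rewrite linear0. Qed.

End Laurent.

Section GaussManin.
Variable K : fieldType.
Local Notation O := (mpoly 2 K).
Local Notation laurent := (laurent K).

(* d - tau df/\, with (df/\) h = h J alpha *)
Definition gmdiff (f g : O) : {linear laurent -> laurent} :=
  lrdiff g \- (ltau K 1 \o lmul (jac f g)).

Lemma lcoef_gmdiff f g k l : lcoef k (gmdiff f g l) =
  rdiff g (lcoef k l) - jac f g * lcoef (k - 1) l.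
Proof.
by rewrite raddfB /= lcoef_rdiff lcoef_tau lcoef_mul.
Qed.

(* The Leibniz rule gives [w tau^k] |-> [k w tau^(k-1) - f w tau^k], i.e. d/dtau - f
   on representatives. *)
Definition ldtauf (f : O) : {linear laurent -> laurent} := ldtau K \- lmul f.

Lemma lcoef_dtauf f k l : lcoef k (ldtauf f l) =
  (k + 1)%:~R *: lcoef (k + 1) l - f * lcoef k l.
Proof. by rewrite raddfB /= lcoef_dtau lcoef_mul. Qed.

Lemma gmdiff_tau f g m l : gmdiff f g (ltau K m l) = ltau K m (gmdiff f g l).
Proof.
apply/lcoefP => k; rewrite !(lcoef_gmdiff, lcoef_tau).
by rewrite [k - 1 - m]addrAC.
Qed.

Lemma gmdiff_mul f g l : gmdiff f g (lmul g l) = lmul g (gmdiff f g l).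
Proof.
apply/lcoefP => k; rewrite !(lcoef_gmdiff, lcoef_mul) /rdiff jacMl jacxx.
by rewrite mulr0 addr0; ring.
Qed.

Lemma gmdiff_dtauf f g l : gmdiff f g (ldtauf f l) = ldtauf f (gmdiff f g l).
Proof.
apply/lcoefP => k; rewrite !(lcoef_gmdiff, lcoef_dtauf) linearB linearZ /=.
rewrite /rdiff jacMl subrK addrK intrD scalerDl !scalerDl !scale1r.
by rewrite -!mul_mpolyC; ring.
Qed.

Definition gauss_manin (f g : O) := coker (gmdiff f g).

HB.instance Definition _ f g := GRing.Lmodule.on (gauss_manin f g).

Section Operators.
Variables f g : O.
Local Notation GM := (gauss_manin f g).

Definition gm_class : {linear laurent -> GM} := cokproj (gmdiff f g).

Definition gm_tau (m : int) : {linear GM -> GM} := cokmap (gmdiff_tau f g m).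
Definition gm_t : {linear GM -> GM} := cokmap (gmdiff_mul f g).
Definition gm_dtau : {linear GM -> GM} := cokmap (gmdiff_dtauf f g).

Definition gm_form (h : O) : GM := gm_class (lmono 0 h).

Lemma gm_tauE m l : gm_tau m (gm_class l) = gm_class (ltau K m l).
Proof. exact: cokmapE. Qed.

Lemma gm_tE l : gm_t (gm_class l) = gm_class (lmul g l).
Proof. exact: cokmapE. Qed.

Lemma gm_dtauE l : gm_dtau (gm_class l) = gm_class (ldtauf f l).
Proof. exact: cokmapE. Qed.

Lemma gm_dtau_form h : gm_dtau (gm_form h) = gm_form (- (f * h)).
Proof.
rewrite gm_dtauE; apply: (congr1 gm_class); apply/lcoefP => k.
rewrite lcoef_dtauf !lcoef_mono [0 == k + 1]eq_sym.
case: (eqVneq (k + 1) 0) => [->|_]; rewrite ?scale0r ?mulr0n ?scaler0 sub0r;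
  by rewrite mulrnAr mulNrn.
Qed.

Definition brieskorn : set GM :=
  [set gm_class l | l in [set l | forall k : int, 0 < k -> lcoef k l = 0]].

Section Fibre.
Variable t0 : K.

Definition gm_shift : {linear GM -> GM} := gm_t \- t0 \*: idfun.

Lemma gm_shiftE x : gm_shift x = gm_t x - t0 *: x.
Proof. by []. Qed.

Lemma gm_shift_tau m x : gm_shift (gm_tau m x) = gm_tau m (gm_shift x).
Proof.
have [l ->] := cokproj_surj x; rewrite !gm_shiftE.
rewrite (linearB (gm_tau m)); congr (_ - _); last by rewrite [RHS]linearZ.
rewrite -/(gm_class l) !(gm_tauE, gm_tE).
apply: (congr1 gm_class); apply/lcoefP => k.
by rewrite !(lcoef_tau, lcoef_mul).
Qed.

Lemma gm_shift_dtau x : gm_shift (gm_dtau x) = gm_dtau (gm_shift x).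
Proof.
have [l ->] := cokproj_surj x; rewrite !gm_shiftE.
rewrite (linearB gm_dtau); congr (_ - _); last by rewrite [RHS]linearZ.
rewrite -/(gm_class l) !(gm_dtauE, gm_tE).
apply: (congr1 gm_class); apply/lcoefP => k.
by rewrite !(lcoef_dtauf, lcoef_mul) mulrBr scalerAr [g * (f * _)]mulrCA.
Qed.

Definition gm_fibre := coker gm_shift.

HB.instance Definition _ := GRing.Lmodule.on gm_fibre.

Definition gmf_class : {linear GM -> gm_fibre} := cokproj gm_shift.

Definition gmf_tau (m : int) : {linear gm_fibre -> gm_fibre} :=
  cokmap (gm_shift_tau m).
Definition gmf_dtau : {linear gm_fibre -> gm_fibre} := cokmap gm_shift_dtau.

Lemma gmf_tauE m x : gmf_tau m (gmf_class x) = gmf_class (gm_tau m x).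
Proof. exact: cokmapE. Qed.

Lemma gmf_dtauE x : gmf_dtau (gmf_class x) = gmf_class (gm_dtau x).
Proof. exact: cokmapE. Qed.

(* G / (t - t0) G injects into the fibre, G being free over K[t, tau^-1], so
   that it is represented by its image. *)
Definition brieskorn_fibre : set gm_fibre := gmf_class @` brieskorn.

End Fibre.

End Operators.

End GaussManin.

Arguments gm_class {K} f g.
Arguments gm_tau {K} f g m.
Arguments gm_t {K} f g.
Arguments gm_dtau {K} f g.
Arguments gm_form {K} f g h.
Arguments brieskorn {K} f g.
Arguments brieskorn_fibre {K} f g t0.
Arguments gmf_class {K} f g t0.
Arguments gmf_tau {K} f g t0 m.
Arguments gmf_dtau {K} f g t0.

Section Filtration.
Variables (K : fieldType) (M : lmodType K) (tau dtau : M -> M).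

Definition tau_act (q : {poly K}) (x : M) : M :=
  \sum_(i < size q) q`_i *: iter i tau x.

Definition tau_submodule (S : set M) : Prop :=
  [/\ S 0, forall a x y, S x -> S y -> S (a *: x + y)
    & forall x, S x -> S (tau x)].

Definition tau_free (S : set M) : Prop :=
  exists B : set M,
  [/\ B `<=` S,
      forall x, S x -> exists s : seq M, exists c : M -> {poly K},
        (forall b, b \in s -> B b) /\ x = \sum_(b <- s) tau_act (c b) b
    & forall (s : seq M) (c : M -> {poly K}), uniq s ->
        (forall b, b \in s -> B b) -> \sum_(b <- s) tau_act (c b) b = 0 ->
        forall b, b \in s -> c b = 0].

Definition filt_lt (V : rat -> set M) (lam : rat) : set M :=
  \bigcup_(l in [set l | l < lam]) V l.

Record malgrange_kashiwara (V : rat -> set M) : Prop := {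
  mk_submodule : forall lam, tau_submodule (V lam);
  mk_increasing : forall lam lam', lam <= lam' -> V lam `<=` V lam';
  mk_exhaustive : forall x, exists lam, V lam x;
  mk_free : forall lam, tau_free (V lam);
  (* K[tau, tau^-1] (x) V_lam is the localisation of V_lam at tau; its map to M
     is injective since tau is invertible on M. *)
  mk_localisation : forall lam x, exists k, V lam (iter k tau x);
  mk_tau : forall lam, tau @` V lam = V (lam - 1);
  mk_dtau : forall lam, dtau @` V lam `<=` V (lam + 1);
  mk_nilpotent : forall lam, exists n, forall x, V lam x ->
    filt_lt V lam (iter n (fun y => tau (dtau y) + ratr lam *: y) x);
  mk_jumps : exists A : seq rat, (forall a, a \in A -> 0 <= a < 1) /\
    forall lam, exists lam',
      let AZ := [set l | exists2 a, a \in A & exists z : int, l = a + z%:~R] in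
      [/\ AZ lam', lam' <= lam, forall l, AZ l -> l <= lam -> l <= lam'
        & V lam = V lam']
}.

(* gr^V_lam (G / tau^-1 G) as the quotient of the first subspace by the second *)
Definition gr_num (V : rat -> set M) (G : set M) (lam : rat) : set M :=
  V lam `&` G.

Definition gr_den (V : rat -> set M) (G tauVG : set M) (lam : rat) : set M :=
  [set x + y | x in V lam `&` tauVG & y in filt_lt V lam `&` G].

End Filtration.

Section Basis.
Variable K : fieldType.
Local Notation O := (mpoly 2 K).

Definition nu (p : 'I_2 -> rat) (e : rat) (h : O) : rat :=
  wdeg p h + \sum_(i < 2) p i - e.

(* (- f)^j h alpha, given h alpha *)
Definition omega (f h : O) (j : nat) : O := (- f) ^+ j * h.

Definition jordan_basis (p : 'I_2 -> rat) (f g : O) (n : nat)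
    (N : 'I_n -> nat) (h : 'I_n -> O) : Prop :=
  [/\ forall i, exists d, whomog p d (h i),
      basis_mod setT (ideal2 g (jac f g)) predT
        (fun ij : {i : 'I_n & 'I_(N i).+1} => omega f (h (tag ij)) (tagged ij))
    & forall i, ideal2 g (jac f g) (f * omega f (h i) (N i))].

(* When nu > 1 one has j > 0, because nu <= 1 for j = 0. *)
Definition omega_tilde (p : 'I_2 -> rat) (e : rat) (f g h : O) (j : nat) :
    gauss_manin f g :=
  let n := nu p e (omega f h j) in
  if 1 < n then
    gm_form f g (omega f h j)
      + ratr (n - 1) *: gm_tau f g (- 1) (gm_form f g (omega f h j.-1))
  else gm_form f g (omega f h j).

Definition lambda (p : 'I_2 -> rat) (e : rat) (f h : O) (j : nat) : rat :=
  let n := nu p e (omega f h j) in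
  if 1 < n then 1 else if 0 <= n then n else 0.

End Basis.

(* Main.v *)
Require Import Defs.
From HB Require Import structures.
From mathcomp Require Import all_boot all_order all_algebra.
From mathcomp Require Import boolp classical_sets reals complex.
From mathcomp Require Import finmap monalg.
From mathcomp Require Import mpoly.
From mathcomp Require Import ring lra zify.

(** The classes of the omega_tilde_i^j form a basis of the fibre over
    C[tau, tau^-1], and the lattice G_t is their span over C[tau^-1]. Give
    tau^k omega_tilde_i^j the order lambda_i^j - k, and let W_l be spanned by the
    elements of order at most l. Once V = W is known the theorem is read off
    coordinates: G_t keeps the exponents k <= 0, its multiple tau^-1 G_t those
    with k <= -1, and of the elements of order exactly lambda only the
    omega_tilde_i^j with lambda_i^j = lambda survive in the quotient
    (gr_basis). Three points carry the proof.

    Basis. A homogeneous h is a combination of Jordan forms of its own degree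
    modulo (g, J). From h = sum c omega + u g + v J one gets
    [h] = sum c [omega] + t [u] + tau^-1 [dv], where u and dv have smaller degree
    than h; induction on the degree shows both that the omega_tilde generate and
    that [h] has order at most max(nu(h), 0) (cform_order). For independence,
    (g - t, J) still is a regular sequence, and the Jordan forms stay independent
    modulo it, as one sees on leading forms (deform_indep, deform_regular); a
    relation over C[tau, tau^-1] is then excluded by descending on its powers of
    tau (monomials_independent).

    Action of tau d/dtau. Along a chain,
    (tau d/dtau + nu) [omega^j] = tau ([omega^(j+1)] + nu tau^-1 [omega^j]), and
    the bracket is omega_tilde^(j+1) when nu > 0, hence of order 1. At the end of
    the chain the bracket has to be estimated otherwise (next_form_end): write
    - f omega^N = u g + v J. Euler's formula for f, g and v gives
    nu v J = f dv + e g jac(f, v); as f and g are coprime, g divides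
    dv + nu omega^N, and the bracket is t times classes of forms of low degree.
    What makes the degree low enough is the bound of the socle degree of a
    homogeneous complete intersection (socle_degree): for (g, J) it says
    nu <= 1 + e - p_1 - p_2 on the basis, and for (f, g) it says nu_i^0 <= 1.

    Uniqueness of V. If V and W are two filtrations, each within a bounded shift
    of the other, on whose graded pieces tau d/dtau + lambda is nilpotent, then a
    product of factors tau d/dtau + a with a <= l moves an element of W_l into
    V_l, and so does a product of factors with a > l; these two products are
    coprime, so the element was in V_l already (eigen_filtration_sub). The shift
    is bounded because V_0, being free over C[tau] and spanning after
    localisation, is finitely generated (MK_bounded). *)

Set Implicit Arguments.
Unset Strict Implicit.
Unset Printing Implicit Defensive.

Import Order.TTheory GRing.Theory Num.Theory.
Local Open Scope ring_scope.
Local Open Scope classical_set_scope.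

(** * Weighted homogeneous polynomials *)

Section WeightedHomogeneous.
Variables (K : numFieldType) (p : 'I_2 -> rat).
Local Notation O := (mpoly 2 K).
Implicit Types (m : 'X_{1..2}) (a b h : O) (d : rat).

Lemma wgt0 : wgt p 0%MM = 0.
Proof. by rewrite /wgt big1 // => i _; rewrite mnm0E mulr0n. Qed.

Lemma wgtD m m' : wgt p (m + m')%MM = wgt p m + wgt p m'.
Proof.
by rewrite /wgt -big_split; apply: eq_bigr => i _; rewrite mnmDE mulrnDr.
Qed.

Lemma wgtU i : wgt p U_(i)%MM = p i.
Proof.
rewrite /wgt (bigD1 i) //= mnm1E eqxx mulr1n big1 ?addr0 // => j ji.
by rewrite mnm1E eq_sym (negPf ji).
Qed.

Lemma whomogX m : whomog p (wgt p m) ('X_[m] : O).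
Proof. by move=> m'; rewrite msuppX inE => /eqP->. Qed.

Lemma whomogXU i : whomog p (p i) ('X_i : O).
Proof. by rewrite -{1}(wgtU i); exact: whomogX. Qed.

Lemma whomogC (c : K) : whomog p 0 (c%:MP : O).
Proof.
by move=> m; rewrite msuppC; case: ifP => // _; rewrite inE => /eqP->; exact: wgt0.
Qed.

Lemma whomogD d a b : whomog p d a -> whomog p d b -> whomog p d (a + b).
Proof. by move=> Ha Hb m /msuppD_le; rewrite mem_cat => /orP[/Ha|/Hb]. Qed.

Lemma whomogZ d c a : whomog p d a -> whomog p d (c *: a).
Proof. by move=> Ha m /msuppZ_le/Ha. Qed.

Lemma whomogN d a : whomog p d a -> whomog p d (- a).
Proof. by move=> Ha m; rewrite (perm_mem (msuppN _)) => /Ha. Qed.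

Lemma whomogB d a b : whomog p d a -> whomog p d b -> whomog p d (a - b).
Proof. by move=> Ha Hb; apply: whomogD => //; exact: whomogN. Qed.

Lemma whomogM d d' a b :
  whomog p d a -> whomog p d' b -> whomog p (d + d') (a * b).
Proof.
move=> Ha Hb m /msuppM_le /allpairsP[[m1 m2] /= [/Ha<- /Hb<- ->]].
by rewrite wgtD.
Qed.

Lemma whomogXn d a n : whomog p d a -> whomog p (d *+ n) (a ^+ n).
Proof.
move=> Ha; elim: n => [|n IHn]; first by rewrite expr0 -mpolyC1; exact: whomogC.
by rewrite exprS mulrS; exact: whomogM.
Qed.

Lemma whomog_deriv d a i : whomog p d a -> whomog p (d - p i) a^`M(i).
Proof.
move=> Ha m; rewrite mcoeff_msupp mcoeff_deriv => nz.
have /Ha <- : (m + U_(i))%MM \in msupp a.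
  by rewrite mcoeff_msupp; apply: contraNneq nz => ->; rewrite mul0rn.
by rewrite wgtD wgtU addrK.
Qed.

Lemma whomog_jac d d' a b : whomog p d a -> whomog p d' b ->
  whomog p (d + d' - (p ord0 + p ord_max)) (jac a b).
Proof.
move=> Ha Hb; rewrite /jac.
have -> : d + d' - (p ord0 + p ord_max) = (d - p ord0) + (d' - p ord_max) by ring.
apply: whomogB; first by apply: whomogM; exact: whomog_deriv.
have -> : (d - p ord0) + (d' - p ord_max) = (d - p ord_max) + (d' - p ord0) by ring.
by apply: whomogM; exact: whomog_deriv.
Qed.

Lemma wdegE d a : a != 0 -> whomog p d a -> wdeg p a = d.
Proof. by move=> /mlead_supp Ha; exact. Qed.

Lemma mcoeffMX_0 i a m : m i = 0%N -> ('X_i * a)@_m = 0.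
Proof.
move=> mi; apply: memN_msupp_eq0; rewrite mulrC (perm_mem (msuppMX _ _)).
by apply/mapP => -[m' _ E]; move: mi; rewrite E mnmDE mnm1E eqxx.
Qed.

Lemma mcoeffXderiv i a m : ('X_i * a^`M(i))@_m = a@_m *+ m i.
Proof.
have [mi|mi] := posnP (m i); first by rewrite mcoeffMX_0 // mi mulr0n.
set k := (m - U_(i))%MM.
have mE : m = (k + U_(i))%MM.
  by apply/mnmP => j; rewrite mnmDE mnmBE mnm1E; case: eqP => [<-|]; lia.
rewrite {1}mE [(k + _)%MM]addmC mulrC mcoeffMX mcoeff_deriv -mE mnmBE mnm1E eqxx.
by congr (_ *+ _); lia.
Qed.

Lemma whomog_euler d h : whomog p d h ->
  \sum_i ratr (p i) *: ('X_i * h^`M(i)) = ratr d *: h.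
Proof.
move=> Hh; apply/mpolyP => m; rewrite raddf_sum /= mcoeffZ.
under eq_bigr => i _ do rewrite mcoeffZ mcoeffXderiv mulrnAr -mulrnAl.
rewrite -mulr_suml.
have [->|nz] := eqVneq h@_m 0; first by rewrite !mulr0.
rewrite -(Hh m) ?mcoeff_msupp // /wgt raddf_sum /=; congr (_ * _).
by apply: eq_bigr => i _; rewrite raddfMn.
Qed.

Definition hcomp d h : O := \sum_(m <- msupp h | wgt p m == d) h@_m *: 'X_[m].

Lemma mcoeff_hcomp d h m : (hcomp d h)@_m = if wgt p m == d then h@_m else 0.
Proof.
rewrite /hcomp raddf_sum /=.
under eq_bigr => i _ do rewrite mcoeffZ mcoeffX.
have [mh|mh] := boolP (m \in msupp h).
  rewrite big_mkcond (bigD1_seq m) ?msupp_uniq //= eqxx mulr1 big1 ?addr0 //.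
  by move=> j /negPf ->; rewrite mulr0 if_same.
rewrite (memN_msupp_eq0 mh) if_same big_seq_cond big1 // => j /andP[jh _].
by case: eqVneq => [ji|]; rewrite ?mulr0 //; rewrite ji (negPf mh) in jh.
Qed.

Lemma hcomp_linear d : linear (hcomp d).
Proof.
move=> a u v; apply/mpolyP => m; rewrite mcoeff_hcomp !linearP /= !mcoeff_hcomp.
by case: ifP => //; rewrite mulr0 addr0.
Qed.

HB.instance Definition _ d := GRing.isLinear.Build K O O *:%R (hcomp d) (hcomp_linear d).

Lemma whomog_hcomp d h : whomog p d (hcomp d h).
Proof.
move=> m; rewrite mcoeff_msupp mcoeff_hcomp.
by case: (wgt p m =P d) => // _; rewrite eqxx.
Qed.

Lemma hcomp_whomog d d' h : whomog p d' h -> hcomp d h = if d' == d then h else 0.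
Proof.
move=> Hh; apply/mpolyP => m; rewrite mcoeff_hcomp.
have [mh|/memN_msupp_eq0 E] := boolP (m \in msupp h).
  by rewrite (Hh _ mh); case: ifP; rewrite ?mcoeff0.
by rewrite E if_same; case: ifP; rewrite ?mcoeff0.
Qed.

Lemma hcomp_id d h : whomog p d h -> hcomp d h = h.
Proof. by move/(hcomp_whomog d); rewrite eqxx. Qed.

Lemma hcompMr d d' a h : whomog p d' a -> hcomp d (h * a) = hcomp (d - d') h * a.
Proof.
move=> Ha; rewrite [h]mpolyE mulr_suml !raddf_sum /= mulr_suml.
apply: eq_bigr => m _; rewrite -!scalerAl !linearZ /=.
rewrite (hcomp_whomog _ (@whomogX m)) (hcomp_whomog _ (whomogM (@whomogX m) Ha)).
have -> : (wgt p m == d - d') = (wgt p m + d' == d) by rewrite eq_sym subr_eq eq_sym.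
by case: ifP; rewrite ?scaler0 ?mul0r -?scalerAl.
Qed.

(** A polynomial is the sum of its homogeneous components, so that linear
    properties may be checked on the latter. *)
Lemma hcomp_ind (P : O -> Prop) h : P 0 -> (forall a b, P a -> P b -> P (a + b)) ->
  (forall d, P (hcomp d h)) -> P h.
Proof.
move=> P0 PD Ph.
have -> : h = \sum_(d <- undup [seq wgt p m | m <- msupp h]) hcomp d h.
  apply/mpolyP => m; rewrite raddf_sum /=.
  under eq_bigr => i _ do rewrite mcoeff_hcomp.
  have [mh|mh] := boolP (m \in msupp h).
    rewrite (bigD1_seq (wgt p m)) ?undup_uniq ?mem_undup ?map_f //= eqxx.
    by rewrite big1 ?addr0 // => j; rewrite eq_sym => /negPf ->.
  by rewrite (memN_msupp_eq0 mh) big1 // => j _; rewrite if_same.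
by apply: (big_ind P) => // d _; exact: Ph.
Qed.

Lemma hcomp_bound h : exists B, forall d, B < d -> hcomp d h = 0.
Proof.
exists (\sum_(m <- msupp h) `|wgt p m|) => d Bd; apply/mpolyP => m.
rewrite mcoeff_hcomp mcoeff0; case: eqP => // md; apply: memN_msupp_eq0.
apply: contraTN Bd => mh; rewrite -leNgt -md (bigD1_seq m) ?msupp_uniq //=.
by rewrite (le_trans (ler_norm _)) // lerDl sumr_ge0.
Qed.

Lemma hcomp_bound_fam (I : finType) (b : I -> O) :
  exists B, forall d i, B < d -> hcomp d (b i) = 0.
Proof.
have /choice[B HB] : forall i, exists B, forall d, B < d -> hcomp d (b i) = 0.
  by move=> i; exact: hcomp_bound.
exists (\sum_i `|B i|) => d i Bd; apply: HB; apply: le_lt_trans Bd.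
by rewrite (bigD1 i) //= (le_trans (ler_norm _)) // lerDl sumr_ge0.
Qed.

Lemma Xn_dvd i k (c : O) :
  (forall m, c@_m != 0 -> (k <= m i)%N) -> exists c' : O, c = 'X_i ^+ k * c'.
Proof.
move=> Hc; exists (\sum_(m <- msupp c) c@_m *: 'X_[m - U_(i) *+ k]).
rewrite mulr_sumr {1}[c]mpolyE big_seq [RHS]big_seq; apply: eq_bigr => m mc.
rewrite -scalerAr mpolyXn -mpolyXD; congr (_ *: 'X_[_]).
apply/mnmP => j; rewrite mnmDE mnmBE mulmnE mnm1E.
case: eqP => [<-|]; rewrite ?mul1n ?mul0n; last by lia.
by move: (Hc m); rewrite -mcoeff_msupp mc => /(_ isT); lia.
Qed.

Lemma mcoeffXnM i k (c : O) m : ('X_i ^+ k * c)@_m != 0 -> (k <= m i)%N.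
Proof.
rewrite mpolyXn -mcoeff_msupp mulrC (perm_mem (msuppMX _ _)) => /mapP[m' _ ->].
by rewrite mnmDE mulmnE mnm1E eqxx; lia.
Qed.

Lemma Xn_coprime k l (c c' : O) : 'X_ord0 ^+ k * c' = 'X_ord_max ^+ l * c ->
  exists c'' : O, c = 'X_ord0 ^+ k * c''.
Proof.
move=> E; apply: Xn_dvd => m cm.
have := @mcoeffXnM ord0 k c' (U_(ord_max) *+ l + m)%MM.
rewrite E mpolyXn mulrC mcoeffMX => /(_ cm).
by rewrite mnmDE mulmnE mnm1E /=; lia.
Qed.

Lemma no_const_term h : h@_0%MM = 0 -> ideal2 ('X_ord0 : O) 'X_ord_max h.
Proof.
move=> h0; rewrite [h]mpolyE big_seq.
apply: (big_ind (ideal2 ('X_ord0 : O) 'X_ord_max)).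
- by exists 0, 0; rewrite !mul0r addr0.
- by move=> _ _ [u [v ->]] [u' [v' ->]]; exists (u + u'), (v + v'); ring.
move=> m mh; have m0 : m != 0%MM by apply: contraTneq mh => ->; rewrite mcoeff_msupp h0 eqxx.
have mE i : (0 < m i)%N -> 'X_[m] = 'X_[m - U_(i)] * 'X_i :> O.
  move=> mi; rewrite -mpolyXD; congr 'X_[_].
  by apply/mnmP => j; rewrite mnmDE mnmBE mnm1E; case: eqP => [<-|]; lia.
have [m00|m00] := posnP (m ord0); last first.
  by exists (h@_m *: 'X_[m - U_(ord0)]), 0; rewrite mul0r addr0 -scalerAl -mE.
have [m01|m01] := posnP (m ord_max); last first.
  by exists 0, (h@_m *: 'X_[m - U_(ord_max)]); rewrite mul0r add0r -scalerAl -mE.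
case/eqP: m0; apply/mnmP => j; rewrite mnm0E.
case: (unliftP ord0 j) => [j' ->|->] //.
by rewrite (ord1 j') -[RHS]m01; congr (m _); exact: val_inj.
Qed.

End WeightedHomogeneous.

Arguments whomogX {K} p m [_] _.
Arguments whomogXU {K} p i [_] _.
Arguments whomog_hcomp {K} p d h [_] _.

(** * Homogeneous complete intersections in the plane *)

Lemma archi_mul (x e : rat) : 0 < e -> exists n : nat, x < n%:R * e.
Proof.
move=> e0; exists (Num.bound (`|x| / e)); rewrite -ltr_pdivrMr //.
apply: le_lt_trans (archi_boundP _); last by rewrite divr_ge0 // ltW.
by rewrite ler_pM2r ?invr_gt0 // ler_norm.
Qed.

Section Ideals.
Variables (K : numFieldType) (p : 'I_2 -> rat).
Hypothesis p_gt0 : forall i, 0 < p i.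
Local Notation O := (mpoly 2 K).
Local Notation X0 := ('X_ord0 : O).
Local Notation X1 := ('X_ord_max : O).
Implicit Types (a b h : O) (d : rat).

Lemma ideal2_hom al be a b d h : whomog p al a -> whomog p be b ->
  whomog p d h -> ideal2 a b h ->
  exists u v, [/\ whomog p (d - al) u, whomog p (d - be) v & h = u * a + v * b].
Proof.
move=> Ha Hb Hh [u [v E]]; exists (hcomp p (d - al) u), (hcomp p (d - be) v).
split; try exact: whomog_hcomp.
by rewrite -(hcomp_id Hh) E raddfD /= (hcompMr _ _ Ha) (hcompMr _ _ Hb).
Qed.

Lemma ideal2D a b h h' : ideal2 a b h -> ideal2 a b h' -> ideal2 a b (h + h').
Proof. by move=> [u [v ->]] [u' [v' ->]]; exists (u + u'), (v + v'); ring. Qed.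

Lemma ideal2Ml a b c h : ideal2 a b h -> ideal2 a b (c * h).
Proof. by move=> [u [v ->]]; exists (c * u), (c * v); ring. Qed.

Lemma whomog_gt0_coeff0 d h : 0 < d -> whomog p d h -> h@_0%MM = 0.
Proof.
move=> d0 Hh; apply: memN_msupp_eq0; apply: contraTN d0 => /Hh <-.
by rewrite wgt0 ltxx.
Qed.

Lemma wgt_ge0 m : 0 <= wgt p m.
Proof. by apply: sumr_ge0 => i _; rewrite mulrn_wge0 // ltW. Qed.

Lemma whomog_lt0 d h : d < 0 -> whomog p d h -> h = 0.
Proof.
move=> d0 Hh; apply/eqP/contraT => /mlead_supp/Hh E.
by move: d0; rewrite -E ltNge wgt_ge0.
Qed.

Lemma whomog_deg0 h : whomog p 0 h -> h = (h@_0%MM)%:MP.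
Proof.
move=> Hh; apply/mpolyP => m; rewrite mcoeffC eq_sym.
case: eqVneq => [<-|m0]; rewrite ?mulr1 // mulr0.
apply: memN_msupp_eq0; apply: contra_neqN m0 => /Hh /eqP.
rewrite /wgt psumr_eq0 => [/allP H|i _]; last by rewrite mulrn_wge0 // ltW.
apply/mnmP => i; rewrite mnm0E; apply/esym.
have /eqP := H i (mem_index_enum i).
by move/eqP; rewrite -mulr_natr mulf_eq0 gt_eqF ?p_gt0 //= pnatr_eq0 => /eqP.
Qed.

(** For homogeneous a and b this says that O / (a, b) has finite dimension. *)
Definition fin_colength a b := exists B, forall h d, whomog p d h -> B < d -> ideal2 a b h.

Lemma spanned_fin_colength al be a b (I : finType) (e : I -> O) :
  whomog p al a -> whomog p be b ->
  (forall h, exists c : I -> K, ideal2 a b (h - \sum_i c i *: e i)) ->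
  fin_colength a b.
Proof.
move=> Ha Hb span; have [B HB] := hcomp_bound_fam p e.
exists B => h d Hh Bd; have [c [u [v E]]] := span h.
exists (hcomp p (d - al) u), (hcomp p (d - be) v).
rewrite -!hcompMr // -raddfD -E raddfB /= (hcomp_id Hh).
suff -> : hcomp p d (\sum_i c i *: e i) = 0 by rewrite subr0.
by rewrite raddf_sum /= big1 // => i _; rewrite linearZ /= HB ?scaler0.
Qed.

(** The syzygies of (a, b) are trivial: for b <> 0 they are generated by
    (b, - a). *)
Definition regular2 a b := forall x y, a * x = b * y -> mdivides b x.

Lemma fin_colength_Xn a b i : fin_colength a b -> exists k, ideal2 a b ('X_i ^+ k).
Proof.
move=> [B HB]; have [n Bn] := archi_mul B (p_gt0 i).
exists n; apply: HB (whomogXn (n := n) (whomogXU p i)) _.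
  by rewrite -mulr_natl.
Qed.

(** The ideal (a, b) kills every syzygy modulo the trivial ones, hence so do the
    powers of X0 and X1 that it contains; as these are coprime monomials, the
    syzygy is itself trivial. *)
Lemma fin_colength_regular a b : b != 0 -> fin_colength a b -> regular2 a b.
Proof.
move=> b0 ab x y E.
have [k [u [v Ek]]] := fin_colength_Xn ord0 ab.
have [l [u' [v' El]]] := fin_colength_Xn ord_max ab.
have E0 : X0 ^+ k * x = b * (u * y + v * x).
  by rewrite Ek mulrDl -mulrA E; ring.
have E1 : X1 ^+ l * x = b * (u' * y + v' * x).
  by rewrite El mulrDl -mulrA E; ring.
have [c Ec] : exists c : O, u * y + v * x = X0 ^+ k * c.
  apply: (@Xn_coprime K k l _ (u' * y + v' * x)).
  by apply: (mulfI b0); rewrite mulrCA -E1 [RHS]mulrCA -E0; ring.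
exists c; apply: (@mulfI _ (X0 ^+ k)); last by rewrite E0 Ec; ring.
by rewrite expf_neq0 // -msupp_eq0 msuppX.
Qed.

(** The determinant of a matrix expressing (a, b) through (X0, X1) generates the
    socle of O / (a, b): comparing the two membership relations for h modulo
    the trivial syzygies of (a, b) and of (X0, X1) produces the cofactor k. *)
Lemma socle_det a0 a1 b0 b1 h :
  let a := a0 * X0 + a1 * X1 in let b := b0 * X0 + b1 * X1 in
  b != 0 -> regular2 a b -> ideal2 a b (X0 * h) -> ideal2 a b (X1 * h) ->
  exists k, ideal2 a b (h - k * (a0 * b1 - a1 * b0)).
Proof.
move=> a b nzb reg [A [B E0]] [C [D E1]].
have X0X1 (x y : O) : X1 * x = X0 * y -> exists z, x = X0 * z /\ y = X1 * z.
  move=> E; have [z Ez] : exists z : O, x = X0 ^+ 1 * z.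
    by apply: (@Xn_coprime K 1 1 _ y); rewrite !expr1.
  exists z; rewrite -[X0]expr1; split => //.
  apply: (@mulfI _ X0); first by rewrite -msupp_eq0 msuppX.
  by rewrite -E Ez expr1; ring.
have [k Ek] : mdivides b (X1 * A - X0 * C).
  apply: (reg _ (X0 * D - X1 * B)).
  have : X1 * (X0 * h) = X0 * (X1 * h) by ring.
  rewrite E0 E1 => E; apply/eqP; rewrite -subr_eq0; apply/eqP.
  by move/eqP: E; rewrite -subr_eq0 => /eqP <-; ring.
have EBD : X1 * B - X0 * D = - k * a.
  apply: (mulfI nzb).
  have : X1 * (X0 * h) = X0 * (X1 * h) by ring.
  rewrite E0 E1 => /eqP; rewrite -subr_eq0 => /eqP E.
  have -> : b * (X1 * B - X0 * D) = - a * (X1 * A - X0 * C) by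
    apply/eqP; rewrite -subr_eq0 -E; apply/eqP; ring.
  by rewrite Ek; ring.
have [m [Em Em']] : exists z, A - k * b1 = X0 * z /\ C + k * b0 = X1 * z.
  apply: X0X1; apply/eqP; rewrite -subr_eq0; apply/eqP.
  have -> : X1 * (A - k * b1) - X0 * (C + k * b0) = X1 * A - X0 * C - k * b.
    by rewrite /b; ring.
  by rewrite Ek; ring.
have [n [En En']] : exists z, B + k * a1 = X0 * z /\ D - k * a0 = X1 * z.
  apply: X0X1; apply/eqP; rewrite -subr_eq0; apply/eqP.
  have -> : X1 * (B + k * a1) - X0 * (D - k * a0) = X1 * B - X0 * D + k * a.
    by rewrite /a; ring.
  by rewrite EBD; ring.
exists k, m, n; apply: (@mulfI _ X0); first by rewrite -msupp_eq0 msuppX.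
have -> : X0 * (m * a + n * b) = (X0 * m) * a + (X0 * n) * b by ring.
by rewrite -Em -En mulrBr E0 /a /b; ring.
Qed.

(** Descending induction on d: X0 h and X1 h lie in (a, b), so h is a multiple of
    the socle generator, whose degree is exactly the bound; the cofactor has
    positive degree, and X0 and X1 kill the socle. *)
Lemma socle_degree al be a b h d : whomog p al a -> whomog p be b ->
  a@_0%MM = 0 -> b@_0%MM = 0 -> b != 0 -> fin_colength a b ->
  whomog p d h -> al + be - (p ord0 + p ord_max) < d -> ideal2 a b h.
Proof.
move=> Ha Hb /no_const_term a00 /no_const_term b00 nzb colen.
have reg := fin_colength_regular nzb colen; have [B HB] := colen.
have [a0 [a1 [Ha0 Ha1 Ea]]] := ideal2_hom (whomogXU p _) (whomogXU p _) Ha a00.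
have [b0 [b1 [Hb0 Hb1 Eb]]] := ideal2_hom (whomogXU p _) (whomogXU p _) Hb b00.
set c0 := al + be - _; set del := a0 * b1 - a1 * b0.
have Hdel : whomog p c0 del.
  rewrite /c0 /del.
  have -> : al + be - (p ord0 + p ord_max) = (al - p ord0) + (be - p ord_max) by ring.
  apply: whomogB; first exact: whomogM.
  have -> : (al - p ord0) + (be - p ord_max) = (al - p ord_max) + (be - p ord0) by ring.
  exact: whomogM.
(* the induction gains at least e in degree at each step *)
pose e := Num.min (p ord0) (p ord_max).
have e0 : 0 < e by rewrite lt_min !p_gt0.
have [ep0 ep1] : e <= p ord0 /\ e <= p ord_max by rewrite !ge_min !lexx orbT.
move=> Hh dc; have [n dn] := archi_mul (B - d) e0.
elim: n => [|n IHn] in h d Hh dc dn *; first by apply: HB Hh _; lra.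
rewrite mulrSr mulrDl mul1r in dn.
have I0 : ideal2 a b (X0 * h).
  by apply: IHn (whomogM (whomogXU p _) Hh) _ _; have := p_gt0 ord0; lra.
have I1 : ideal2 a b (X1 * h).
  by apply: IHn (whomogM (whomogXU p _) Hh) _ _; have := p_gt0 ord_max; lra.
have [k [m [q E]]] : exists k, ideal2 a b (h - k * del).
  by rewrite Ea Eb; apply: socle_det; rewrite -?Ea -?Eb.
have -> : h = (h - hcomp p (d - c0) k * del) + hcomp p (d - c0) k * del by ring.
apply: ideal2D.
  rewrite -(hcompMr _ _ Hdel) -{1}(hcomp_id Hh) -raddfB /= E.
  exists (hcomp p (d - al) m), (hcomp p (d - be) q).
  by rewrite raddfD /= (hcompMr _ _ Ha) (hcompMr _ _ Hb).
have [k0 [k1 ->]] : ideal2 X0 X1 (hcomp p (d - c0) k).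
  apply: no_const_term; apply: whomog_gt0_coeff0 (whomog_hcomp p _ _).
  by rewrite subr_gt0.
(* X0 * del = b1 * a - a1 * b and X1 * del = a0 * b - b0 * a *)
exists (k0 * b1 - k1 * b0), (k1 * a0 - k0 * a1).
by rewrite /del Ea Eb; ring.
Qed.

End Ideals.

(** * Deformation of a graded basis *)

(** A principal ideal containing powers of both variables is the unit ideal. *)
Lemma fin_colength_neq0 (K : numFieldType) (p : 'I_2 -> rat) (a b : mpoly 2 K) :
  (forall i, 0 < p i) -> fin_colength p a b -> a \isn't a GRing.unit -> b != 0.
Proof.
move=> p_gt0 ab; apply: contra => /eqP b0.
have [k [u [v]]] := fin_colength_Xn p_gt0 ord0 ab; rewrite b0 mulr0 addr0 => Ek.
have [l [u' [v']]] := fin_colength_Xn p_gt0 ord_max ab; rewrite b0 mulr0 addr0 => El.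
have [c Ec] : exists c : mpoly 2 K, u = 'X_ord0 ^+ k * c.
  by apply: (@Xn_coprime K k l _ u'); rewrite Ek El; ring.
apply/unitrPr; exists c; apply: (@mulfI _ ('X_ord0 ^+ k)).
  by rewrite expf_neq0 // -msupp_eq0 msuppX.
by rewrite mulr1 [RHS]Ek Ec; ring.
Qed.

Section GradedBasis.
Variables (K : numFieldType) (p : 'I_2 -> rat).
Hypothesis p_gt0 : forall i, 0 < p i.
Local Notation O := (mpoly 2 K).
Variables (a b : O) (e j : rat).
Hypotheses (e_gt0 : 0 < e) (Ha : whomog p e a) (Hb : whomog p j b) (b_neq0 : b != 0).
Variables (I : finType) (w : I -> O) (dw : I -> rat).
Hypothesis Hw : forall i, whomog p (dw i) (w i).
Hypothesis w_basis : basis_mod setT (ideal2 a b) predT w.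

Lemma hcomp_comb d (c : I -> K) :
  hcomp p d (\sum_i c i *: w i) = \sum_i (if dw i == d then c i else 0) *: w i.
Proof.
rewrite raddf_sum /=; apply: eq_bigr => i _; rewrite linearZ /= (hcomp_whomog _ (@Hw i)).
by case: ifP; rewrite ?scaler0 ?scale0r.
Qed.

Lemma basis_indep (c : I -> K) : ideal2 a b (\sum_i c i *: w i) -> forall i, c i = 0.
Proof. by case: w_basis => _ _ H /H Hc i; exact: Hc. Qed.

Lemma basis_fin_colength : fin_colength p a b.
Proof.
apply: (spanned_fin_colength (e := w) Ha Hb) => h.
by case: w_basis => _ + _ => /(_ h Logic.I).
Qed.

Lemma basis_regular : regular2 a b.
Proof. exact: fin_colength_regular b_neq0 basis_fin_colength. Qed.

(** Taking the component of degree d of any decomposition keeps only the basis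
    forms of degree d; the degrees of u and v are what inductions use. *)
Lemma basis_hom_decomp d h : whomog p d h -> exists c u v,
  [/\ h = \sum_i c i *: w i + u * a + v * b, forall i, dw i != d -> c i = 0,
      whomog p (d - e) u & whomog p (d - j) v].
Proof.
move=> Hh; case: w_basis => _ /(_ h Logic.I)[c [u [v E]]] _.
exists (fun i => if dw i == d then c i else 0), (hcomp p (d - e) u), (hcomp p (d - j) v).
split; try exact: whomog_hcomp; last by move=> i /negPf ->.
rewrite -hcomp_comb -(hcompMr _ _ Ha) -(hcompMr _ _ Hb) -addrA -raddfD -E.
by rewrite -raddfD /= addrCA subrr addr0 hcomp_id.
Qed.

Lemma basis_notin i : ~ ideal2 a b (w i).
Proof.
move=> wi; have := @basis_indep (fun k => (k == i)%:R) _ i; rewrite eqxx => H.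
suff /H/eqP : ideal2 a b (\sum_k (k == i)%:R *: w k) by rewrite oner_eq0.
rewrite (bigD1 i) //= eqxx scale1r big1 ?addr0 // => k /negPf ->.
by rewrite scale0r.
Qed.

Lemma basis_neq0 i : w i != 0.
Proof.
apply/eqP => wi; apply: (@basis_notin i); rewrite wi.
by exists 0, 0; rewrite !mul0r addr0.
Qed.

Section Deformation.
Variables (t : K) (c : I -> K) (x y : O).
Hypothesis E : \sum_i c i *: w i = x * b + y * (a - t%:MP).

(** In degree d + e the relation E becomes one modulo (a, b), up to the term
    t y_(d + e), which the hypothesis puts into (b). Hence divisibility descends
    from degree d + e to degree d. *)
Lemma deform_step d : mdivides b (hcomp p (d + e) y) ->
  mdivides b (hcomp p d y) /\ forall i, dw i = d + e -> c i = 0.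
Proof.
move=> [q Eq].
have Ec : \sum_i (if dw i == d + e then c i else 0) *: w i =
    hcomp p d y * a + (hcomp p (d + e - j) x - t *: q) * b.
  rewrite -hcomp_comb E mulrBr raddfD raddfB /= (hcompMr _ _ Ha) (hcompMr _ _ Hb).
  rewrite addrK mulrC [y * _]mulrC mul_mpolyC linearZ /= Eq -!mul_mpolyC.
  by rewrite [_ + e - j]addrAC; ring.
have c0 : forall i, (if dw i == d + e then c i else 0) = 0.
  by apply: basis_indep; rewrite Ec; exists (hcomp p d y), (hcomp p (d + e - j) x - t *: q).
split=> [|i di]; last by have := c0 i; rewrite di eqxx.
apply: (basis_regular (y := t *: q - hcomp p (d + e - j) x)).
move: Ec; rewrite big1 => [/esym/eqP|i _]; last by rewrite c0 scale0r.
by rewrite addr_eq0 => /eqP E0; rewrite mulrC E0; ring.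
Qed.

Lemma deform_dvd d : mdivides b (hcomp p d y).
Proof.
have [B HB] := hcomp_bound p y; have [n Bn] := archi_mul (B - d) e_gt0.
elim: n d Bn => [|n IHn] d Bn.
  by exists 0; rewrite mul0r HB //; lra.
rewrite mulrSr mulrDl mul1r in Bn.
by have [] := @deform_step d; first by apply: IHn; lra.
Qed.

Lemma deform_indep i : c i = 0.
Proof.
have [_] := @deform_step (dw i - e) (deform_dvd _).
by apply; rewrite subrK.
Qed.

Lemma deform_mdivides : mdivides b y.
Proof.
apply: (@hcomp_ind K p (mdivides b)) deform_dvd; first by exists 0; rewrite mul0r.
by move=> _ _ [q ->] [q' ->]; exists (q + q'); rewrite mulrDl.
Qed.

End Deformation.

(** The case c = 0 of the above: triviality of the syzygies passes from a to
    a - t. *)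
Lemma deform_regular t (x y : O) :
  x * b = y * (a - t%:MP) -> mdivides (a - t%:MP) x.
Proof.
move=> E; have [q Eq] : mdivides b (- y).
  apply: (@deform_mdivides t (fun=> 0) x); rewrite big1 => [|i _]; last by rewrite scale0r.
  by rewrite E; ring.
exists (- q); apply: (mulIf b_neq0); rewrite E -[y]opprK Eq; ring.
Qed.

End GradedBasis.

(** * Spans of an indexed family, products of shifted operators *)

Section FreeSpan.
Variables (K : fieldType) (M : lmodType K) (T : eqType) (e : T -> M).
Implicit Types (c : T -> K) (s : seq T) (A B : T -> Prop) (x y : M).

Definition subspace (S : set M) := S 0 /\ forall a x y, S x -> S y -> S (a *: x + y).

Lemma subspaceD S x y : subspace S -> S x -> S y -> S (x + y).
Proof. by move=> [_ H] Sx Sy; rewrite -[x]scale1r; exact: H. Qed.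

Lemma subspaceZ S a x : subspace S -> S x -> S (a *: x).
Proof. by move=> [S0 H] Sx; rewrite -[_ *: _]addr0; exact: H. Qed.

Lemma subspaceB S x y : subspace S -> S x -> S y -> S (x - y).
Proof. by move=> HS Sx Sy; rewrite addrC -scaleN1r; apply: HS.2. Qed.

Lemma subspace_sum S (J : Type) (r : seq J) (P : pred J) (F : J -> M) :
  subspace S -> (forall j, P j -> S (F j)) -> S (\sum_(j <- r | P j) F j).
Proof. by move=> HS HF; apply: big_ind => //; [exact: HS.1|move=> ? ?; exact: subspaceD]. Qed.

(** Coordinates are functions of finite support; the support is kept as a list
    since T need not be finite. *)
Definition represents c x := exists2 s, uniq s &
  (forall t, t \notin s -> c t = 0) /\ x = \sum_(t <- s) c t *: e t.

Definition espan A : set M := [set x | exists2 c, represents c x & forall t, c t != 0 -> A t].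

Lemma sum_widen c s s' : uniq s -> uniq s' -> {subset s <= s'} ->
  (forall t, t \notin s -> c t = 0) ->
  \sum_(t <- s) c t *: e t = \sum_(t <- s') c t *: e t.
Proof.
move=> us us' ss' c0; rewrite [RHS](bigID (mem s)) /= addrC [X in _ = X + _]big1 => [|t ts].
  rewrite add0r -[RHS]big_filter; apply: perm_big; apply: uniq_perm => //.
    exact: filter_uniq.
  by move=> t; rewrite mem_filter; case: (boolP (t \in s)) => // /ss'.
by rewrite c0 ?scale0r.
Qed.

Lemma represents_lin a c c' x y : represents c x -> represents c' y ->
  represents (fun t => a * c t + c' t) (a *: x + y).
Proof.
move=> [s us [c0 ->]] [s' us' [c0' ->]]; exists (undup (s ++ s')); first exact: undup_uniq.
have ss : {subset s <= undup (s ++ s')} by move=> t ts; rewrite mem_undup mem_cat ts.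
have ss' : {subset s' <= undup (s ++ s')}.
  by move=> t ts; rewrite mem_undup mem_cat ts orbT.
split=> [t|].
  by rewrite mem_undup mem_cat negb_or => /andP[/c0-> /c0'->]; rewrite mulr0 addr0.
rewrite (sum_widen us (undup_uniq _) ss c0) (sum_widen us' (undup_uniq _) ss' c0').
rewrite scaler_sumr -big_split; apply: eq_bigr => t _.
by rewrite scalerDl scalerA.
Qed.

Lemma represents0 : represents (fun=> 0) 0.
Proof. by exists [::] => //; split=> //; rewrite big_nil. Qed.

Lemma espan_subspace A : subspace (espan A).
Proof.
split; first by exists (fun=> 0); [exact: represents0|move=> t; rewrite eqxx].
move=> a x y [c rc cA] [c' rc' cA']; exists (fun t => a * c t + c' t).
  exact: represents_lin.
move=> t nz; have [ct|/eqP ct] := eqVneq (c t) 0; last exact/cA/eqP.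
by apply: cA'; move: nz; rewrite ct mulr0 add0r.
Qed.

Lemma espan_gen A t : A t -> espan A (e t).
Proof.
move=> At; exists (fun t' => (t' == t)%:R).
  exists [:: t] => //; split=> [t'|]; first by rewrite inE; case: eqP.
  by rewrite big_seq1 eqxx scale1r.
by move=> t'; case: (t' =P t) => [->|] //; rewrite eqxx.
Qed.

Lemma espan_min A S : subspace S -> (forall t, A t -> S (e t)) -> espan A `<=` S.
Proof.
move=> HS AS x [c [s us [c0 ->]] cA]; apply: subspace_sum => // t _.
have [->|/cA/AS] := eqVneq (c t) 0; first by rewrite scale0r; exact: HS.1.
exact: subspaceZ.
Qed.

Lemma espanS A B : (forall t, A t -> B t) -> espan A `<=` espan B.
Proof.
by move=> AB; apply: espan_min; [exact: espan_subspace|move=> t /AB; exact: espan_gen].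
Qed.

Definition independent := forall s c, uniq s ->
  \sum_(t <- s) c t *: e t = 0 -> forall t, t \in s -> c t = 0.

Hypothesis e_indep : independent.

Lemma represents_inj c c' x : represents c x -> represents c' x -> c =1 c'.
Proof.
move=> rc rc' t; have := represents_lin (-1) rc rc'.
rewrite scaleN1r addNr => -[s us [c0 /esym/e_indep H]].
apply/esym/eqP; rewrite -subr_eq0 addrC -mulN1r; apply/eqP.
by have [ts|ts] := boolP (t \in s); [exact: H|exact: c0].
Qed.

Lemma espanI A B x : espan A x -> espan B x -> espan (fun t => A t /\ B t) x.
Proof.
move=> [c rc cA] [c' rc' cB]; exists c => // t ct; split; first exact: cA.
by apply: cB; rewrite -(represents_inj rc rc').
Qed.

Lemma espan_neq a t : espan (fun t' => t' <> t) (a *: e t) -> a = 0.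
Proof.
move=> H; have /(espanI H) : espan (eq^~ t) (a *: e t).
  by apply: subspaceZ; [exact: espan_subspace|exact: espan_gen].
move=> [c [s us [c0 Ec]] cA].
have c00 t' : c t' = 0 by apply/eqP/contraT => /cA[].
move: Ec; rewrite big1 => [E|t' _]; last by rewrite c00 scale0r.
apply: (e_indep (s := [:: t]) (c := fun=> a)) => //; last exact: mem_head.
by rewrite big_seq1.
Qed.

End FreeSpan.

(** Puts the jumps of two filtrations into one set of indices m / D. *)
Lemma common_denominator (s : seq rat) : exists2 D : nat, (0 < D)%N &
  forall a, a \in s -> exists z : int, a * D%:R = z%:~R.
Proof.
elim: s => [|a s [D D0 HD]]; first by exists 1%N.
exists (D * `|denq a|)%N; first by rewrite muln_gt0 D0 absz_gt0 denq_neq0.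
have Ea : `|denq a|%:R = (denq a)%:~R :> rat by rewrite pmulrn absz_denq.
move=> x; rewrite inE natrM Ea => /predU1P[->|/HD[z Ez]].
  exists (numq a * D); rewrite mulrCA intrM mulrC; congr (_ * _).
  by rewrite -{1}[a]divq_num_den divfK // intr_eq0 denq_neq0.
by exists (z * denq a); rewrite mulrA Ez intrM.
Qed.

Section Factors.
Variables (K : fieldType) (M : lmodType K) (T : {linear M -> M}).

Definition factors (L : seq K) (x : M) : M := foldr (fun a y => T y + a *: y) x L.

Lemma factors_cat L L' x : factors (L ++ L') x = factors L (factors L' x).
Proof. exact: foldr_cat. Qed.

Lemma factors_comm L a x : factors L (T x + a *: x) = T (factors L x) + a *: factors L x.
Proof.
elim: L => //= b L ->; move: (factors L x) => y.
have -> : T (T y + a *: y) = T (T y) + a *: T y by rewrite linearD linearZ.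
have -> : T (T y + b *: y) = T (T y) + b *: T y by rewrite linearD linearZ.
rewrite !scalerDr !scalerA [b * a]mulrC -!addrA; congr (_ + _).
by rewrite addrCA.
Qed.

Variables (S : set M) (S_sub : subspace S) (S_stable : forall x, S x -> S (T x)).

Lemma factors_mod L a x : S (T x + a *: x) ->
  S (factors L x - (\prod_(b <- L) (b - a)) *: x).
Proof.
move=> Sx; elim: L => [|b L IHL] /=.
  by rewrite big_nil scale1r subrr; exact: S_sub.1.
rewrite big_cons; set pi := \prod_(_ <- _) _ in IHL *.
have -> : T (factors L x) + b *: factors L x - ((b - a) * pi) *: x =
    (T (factors L x - pi *: x) + b *: (factors L x - pi *: x)) + pi *: (T x + a *: x).
  have -> : T (factors L x - pi *: x) = T (factors L x) - pi *: T x.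
    by rewrite linearB linearZ.
  rewrite !scalerBr !scalerDr !scalerA mulrBl scalerBl [a * pi]mulrC opprB.
  rewrite -!addrA; congr (_ + _); rewrite [RHS]addrCA; congr (_ + _).
  by rewrite [RHS]addrCA addKr [RHS]addrC.
apply: subspaceD => //; last exact: subspaceZ.
by rewrite addrC; apply: S_sub.2 => //; exact: S_stable.
Qed.

(** Modulo S, a first factor T + a acts on x by zero (induction), so that the
    product over L' acts by the nonzero scalar prod (b - a). *)
Lemma factors_coprime L L' x : {in L & L', forall a b, a != b} ->
  S (factors L x) -> S (factors L' x) -> S x.
Proof.
elim: L x => //= a L IHL x LL' SL SL'.
have Sa : S (T x + a *: x).
  apply: IHL; first by move=> b c bL cL; apply: LL' => //; rewrite inE bL orbT.
    by rewrite factors_comm.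
  by rewrite factors_comm addrC; apply: S_sub.2 => //; exact: S_stable.
have Spi : S ((\prod_(b <- L') (b - a)) *: x).
  by have := subspaceB S_sub SL' (factors_mod L' Sa); rewrite subKr.
have nz : \prod_(b <- L') (b - a) != 0.
  rewrite prodf_seq_neq0; apply/allP => b bL' /=.
  by rewrite subr_eq0 eq_sym LL' ?mem_head.
by have := subspaceZ (\prod_(b <- L') (b - a))^-1 S_sub Spi; rewrite scalerA mulVf ?scale1r.
Qed.

End Factors.

(** * Filtrations of a module over Laurent polynomials *)

Section Filtrations.
Variables (K : numFieldType) (M : lmodType K) (T : {linear M -> M}).
Variable D : nat.
Hypothesis D_gt0 : (0 < D)%N.

Definition level (m : int) : rat := m%:~R / D%:R.

Lemma level_lt m m' : (level m < level m') = (m < m').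
Proof. by rewrite /level ltr_pM2r ?invr_gt0 ?ltr0n // ltr_int. Qed.

Lemma level_floor l : level (Num.floor (l * D%:R)) <= l.
Proof. by rewrite ler_pdivrMr ?ltr0n // Num.Theory.floor_le. Qed.

Definition eigen_filtration (V : int -> set M) := forall m,
  [/\ subspace (V m), forall x, V m x -> V m (T x)
    & exists n, forall x, V m x ->
        V (m - 1) (iter n (fun y => T y + ratr (level m) *: y) x)].

(** Descending r steps in the filtration costs a product of factors T + m' / D
    with m' in the interval ]m - r, m]. *)
Lemma eigen_filtration_factors V : eigen_filtration V -> forall (r : nat) m,
  exists2 L, (forall a, a \in L ->
      exists2 m', (m - r%:Z < m') && (m' <= m) & a = ratr (level m'))
    & forall x, V m x -> V (m - r%:Z) (factors T L x).
Proof.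
move=> HV; elim=> [|r IHr] m; first by exists [::] => //= x; rewrite subr0.
have [_ _ [n Hn]] := HV m; have [L HL VL] := IHr (m - 1).
have mr : m - 1 - r%:Z = m - r.+1%:Z by lia.
rewrite mr in HL VL; exists (L ++ nseq n (ratr (level m))).
  move=> a; rewrite mem_cat => /orP[/HL[m' lm' ->]|/nseqP[-> _]].
    by exists m' => //; lia.
  by exists m => //; lia.
move=> x Vx; rewrite factors_cat; apply: VL.
suff -> : factors T (nseq n (ratr (level m))) x =
  iter n (fun y => T y + ratr (level m) *: y) x by exact: Hn.
by elim: n {Hn} => //= n ->.
Qed.

(** An element of W_m is moved into V_m by factors T + m' / D with m' <= m,
    through W_(m - r), and also by factors with m' > m, from V_(m + r). *)
Lemma eigen_filtration_sub W V (r : nat) : eigen_filtration W -> eigen_filtration V ->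
  (forall m, W m `<=` V (m + r%:Z)) -> forall m, W m `<=` V m.
Proof.
move=> HW HV WV m x Wx; have [Vm Vs _] := HV m.
have [L HL WL] := eigen_filtration_factors HW r m.
have [L' HL' VL'] := eigen_filtration_factors HV r (m + r%:Z).
apply: (factors_coprime (T := T) Vm Vs (L := L) (L' := L')); first last.
- by rewrite -[m](addrK r%:Z); apply: VL'; exact: WV.
- by rewrite -[m](subrK r%:Z); apply/WV/WL.
move=> _ _ /HL[m1 /andP[_ m1m] ->] /HL'[m2 /andP[m2m _] ->].
rewrite (inj_eq (fmorph_inj _)) neq_lt level_lt; apply/orP; left.
by apply: le_lt_trans m1m _; move: m2m; rewrite addrK.
Qed.

End Filtrations.

(** Here M is free over K[tau, tau^-1] with basis b, where tp k stands for the
    multiplication by tau^k. The vector b i is given the order lam i; applied to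
    it, tau d/dtau + lam i does not raise the order, and its square lowers it. *)
Section LatticeBasis.
Variables (K : numFieldType) (M : lmodType K) (I : finType).
Variables (tp : int -> {linear M -> M}) (dtau : {linear M -> M}).
Hypothesis tp0 : forall x, tp 0 x = x.
Hypothesis tpD : forall k l x, tp (k + l) x = tp k (tp l x).
Hypothesis dtau_tp : forall k x, dtau (tp k x) = tp k (dtau x) + k%:~R *: tp (k - 1) x.
Variables (b : I -> M) (lam : I -> rat).

Definition Euler_op : {linear M -> M} := tp 1 \o dtau.
Local Notation T := Euler_op.

Definition monomial (t : I * int) : M := tp t.2 (b t.1).
Definition monomial_order (t : I * int) : rat := lam t.1 - t.2%:~R.
Definition below l : set M := espan monomial (fun t => monomial_order t <= l).
Definition strictly_below l : set M := espan monomial (fun t => monomial_order t < l).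

Hypothesis monomials_span : forall x, espan monomial (fun=> True) x.
Hypothesis monomials_indep : independent monomial.
Hypothesis Tb : forall i, below (lam i) (T (b i) + ratr (lam i) *: b i).
Hypothesis TTb : forall i, let y := T (b i) + ratr (lam i) *: b i in
  strictly_below (lam i) (T y + ratr (lam i) *: y).

Lemma tpK k x : tp (- k) (tp k x) = x.
Proof. by rewrite -tpD addNr tp0. Qed.

Lemma below_subspace l : subspace (below l). Proof. exact: espan_subspace. Qed.

Lemma strictly_below_subspace l : subspace (strictly_below l).
Proof. exact: espan_subspace. Qed.

Lemma strictly_belowW l l' : l <= l' -> strictly_below l `<=` below l'.
Proof. by move=> ll'; apply: espanS => t /ltW/le_trans; exact. Qed.

Lemma belowS l l' : l <= l' -> below l `<=` below l'.
Proof. by move=> ll'; apply: espanS => t /le_trans; exact. Qed.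

Lemma below_strictly l l' : l < l' -> below l `<=` strictly_below l'.
Proof. by move=> ll'; apply: espanS => t /le_lt_trans; exact. Qed.

Lemma subspace_tp k S : subspace S -> subspace [set x | S (tp k x)].
Proof.
move=> [S0 SD]; split=> /=; first by rewrite linear0.
by move=> a x y Sx Sy; rewrite linearP; exact: SD.
Qed.

Lemma tp_below k l x : below l x -> below (l - k%:~R) (tp k x).
Proof.
apply: (espan_min (S := [set x | below (l - k%:~R) (tp k x)])).
  by apply: subspace_tp; exact: below_subspace.
move=> [i m] /=; rewrite /monomial_order /monomial /= -tpD => Hm.
apply: (@espan_gen _ _ _ monomial _ (i, k + m)); rewrite /monomial_order /= intrD; lra.
Qed.

Lemma tp_strictly_below k l x : strictly_below l x -> strictly_below (l - k%:~R) (tp k x).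
Proof.
apply: (espan_min (S := [set x | strictly_below (l - k%:~R) (tp k x)])).
  by apply: subspace_tp; exact: strictly_below_subspace.
move=> [i m] /=; rewrite /monomial_order /monomial /= -tpD => Hm.
apply: (@espan_gen _ _ _ monomial _ (i, k + m)); rewrite /monomial_order /= intrD; lra.
Qed.

Lemma Euler_tp k x : T (tp k x) = tp k (T x + k%:~R *: x).
Proof.
rewrite /= dtau_tp !linearD !linearZ /= -!tpD; congr (_ + _ *: tp _ _).
  by rewrite addrC.
by ring.
Qed.

Definition shifted a : {linear M -> M} := T \+ a \*: idfun.

Lemma shifted_tp a k x : shifted a (tp k x) = tp k (shifted (a + k%:~R) x).
Proof.
have -> : shifted a (tp k x) = T (tp k x) + a *: tp k x by [].
rewrite Euler_tp -linearZ -linearD; congr (tp k _).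
have -> : shifted (a + k%:~R) x = T x + (a + k%:~R) *: x by [].
by rewrite scalerDl -addrA [k%:~R *: x + _]addrC.
Qed.

Lemma shifted_below l a x : below l x -> below l (shifted a x).
Proof.
move=> lx; have Tl : below l (T x).
  move: x lx; apply: (espan_min (S := [set x | below l (T x)])).
    split=> /=; first by rewrite !linear0; exact: (below_subspace _).1.
    move=> c x y; rewrite !linearP; exact: (below_subspace _).2.
  move=> [i k]; rewrite /monomial_order /monomial /= => ikl.
  have -> : tp 1 (dtau (tp k (b i))) =
      tp k (shifted (ratr (lam i)) (b i)) + (k%:~R - ratr (lam i)) *: tp k (b i).
    rewrite -[LHS]/(T _) Euler_tp -linearZ -linearD; congr (tp k _).
    by rewrite [RHS]/= -addrA -scalerDl [ratr _ + _]addrC subrK.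
  apply: (belowS ikl); apply: subspaceD (below_subspace _) _ _.
    exact/tp_below/Tb.
  apply: subspaceZ (below_subspace _) _.
  exact: (@espan_gen _ _ _ monomial _ (i, k)).
have -> : shifted a x = a *: x + T x by rewrite addrC.
exact: (below_subspace l).2.
Qed.

Lemma shifted_strictly_below l a x :
  strictly_below l x -> strictly_below l (shifted a x).
Proof.
apply: (espan_min (S := [set x | strictly_below l (shifted a x)])).
  split=> [|c x' y Sx Sy]; have [S0 SD] := strictly_below_subspace l.
    by rewrite /mkset (linear0 (shifted _)).
  by rewrite /mkset (linearP (shifted _)); exact: SD.
move=> t tl; apply: (below_strictly tl); apply: shifted_below.
exact: espan_gen.
Qed.

Lemma shifted2_below l x : below l x ->
  strictly_below l (shifted (ratr l) (shifted (ratr l) x)).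
Proof.
apply: (espan_min (S := [set x | strictly_below l (shifted (ratr l) (shifted (ratr l) x))])).
  have [S0 SD] := strictly_below_subspace l.
  split=> [|c x' y Sx Sy].
    by rewrite /mkset !(linear0 (shifted _)).
  by rewrite /mkset !(linearP (shifted _)); exact: SD.
move=> [i k]; rewrite le_eqVlt => /predU1P[<-|ikl].
  have -> : monomial (i, k) = tp k (b i) by [].
  have -> : monomial_order (i, k) = lam i - k%:~R by [].
  rewrite /mkset !shifted_tp rmorphB /= ratr_int subrK.
  by apply: tp_strictly_below; exact: TTb.
apply: (below_strictly ikl); do 2!apply: shifted_below.
exact: espan_gen.
Qed.

Lemma below_exhaustive x : exists l, below l x.
Proof.
have [c [s us [c0 ->]] _] := monomials_span x.
exists (\sum_(t <- s) `|monomial_order t|); rewrite [X in below _ X]big_seq.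
apply: subspace_sum => [|t ts]; first exact: below_subspace.
apply: subspaceZ; first exact: below_subspace.
apply: espan_gen; rewrite /= (bigD1_seq t) //= (le_trans (ler_norm _)) //.
by rewrite lerDl sumr_ge0.
Qed.

Lemma iter_tp n x : iter n (tp 1) x = tp n%:Z x.
Proof. by elim: n => [|n /= ->]; rewrite ?tp0 // -tpD. Qed.

Lemma tau_actE n (q : {poly K}) x : (size q <= n)%N ->
  tau_act (tp 1) q x = \sum_(i < n) q`_i *: tp i%:Z x.
Proof.
move=> qn; rewrite /tau_act (big_ord_widen n (fun i => q`_i *: iter i (tp 1) x) qn).
rewrite big_mkcond; apply: eq_bigr => i _; rewrite iter_tp.
by case: ltnP => // iq; rewrite nth_default ?scale0r.
Qed.

Lemma tau_actD a (q q' : {poly K}) x :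
  tau_act (tp 1) (a *: q + q') x = a *: tau_act (tp 1) q x + tau_act (tp 1) q' x.
Proof.
pose n := maxn (size q) (size q').
rewrite !(@tau_actE n) ?leq_maxl ?leq_maxr //; last first.
  rewrite (leq_trans (size_polyD _ _)) // geq_max leq_maxr andbT.
  exact: leq_trans (size_scale_leq _ _) (leq_maxl _ _).
rewrite scaler_sumr -big_split; apply: eq_bigr => i _.
by rewrite coefD coefZ scalerDl scalerA.
Qed.

Lemma tau_actXM (q : {poly K}) x : tau_act (tp 1) ('X * q) x = tp 1 (tau_act (tp 1) q x).
Proof.
rewrite (@tau_actE (size q).+1); last first.
  by rewrite (leq_trans (size_polyMleq _ _)) // size_polyX.
rewrite big_ord_recl coefXM eqxx scale0r add0r (@tau_actE (size q)) // linear_sum.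
apply: eq_bigr => i _; rewrite coefXM /= linearZ /= -tpD; congr (_ *: tp _ _).
Qed.

Lemma tau_actXn n x : tau_act (tp 1) 'X^n x = tp n%:Z x.
Proof.
rewrite (@tau_actE n.+1) ?size_polyXn // big_ord_recr /= coefXn eqxx scale1r.
by rewrite big1 ?add0r // => i _; rewrite coefXn ltn_eqF ?scale0r.
Qed.

Definition tau_span (s : seq M) : set M :=
  [set x | exists c : M -> {poly K}, x = \sum_(y <- s) tau_act (tp 1) (c y) y].

Lemma tau_span_subspace s : subspace (tau_span s).
Proof.
split.
  exists (fun=> 0); rewrite big1 // => y _.
  by rewrite (@tau_actE 0) ?size_poly0 ?big_ord0.
move=> a x y [c ->] [c' ->]; exists (fun z => a *: c z + c' z).
by rewrite scaler_sumr -big_split; apply: eq_bigr => z _; rewrite tau_actD.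
Qed.

Lemma tau_span_tau s n x : tau_span s x -> tau_span s (tp n%:Z x).
Proof.
elim: n x => [|n IHn] x sx; first by rewrite tp0.
rewrite -[n.+1%:Z]/(1 + n%:Z) tpD; have [c ->] := IHn _ sx.
exists (fun y => 'X * c y); rewrite linear_sum.
by apply: eq_bigr => y _; rewrite tau_actXM.
Qed.

Lemma tau_span_gen s (q : {poly K}) y : uniq s -> y \in s -> tau_span s (tau_act (tp 1) q y).
Proof.
move=> us ys; exists (fun z => if z == y then q else 0).
rewrite (bigD1_seq y) //= eqxx big1 ?addr0 // => z /negPf ->.
by rewrite (@tau_actE 0) ?size_poly0 ?big_ord0.
Qed.

Variables (V : rat -> set M) (MK : malgrange_kashiwara (tp 1) dtau V).

Lemma MK_subspace l : subspace (V l).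
Proof. by have [S0 SD _] := mk_submodule MK l; split. Qed.

Lemma MK_tau l x : V l x <-> V (l - 1) (tp 1 x).
Proof.
rewrite -(mk_tau MK); split=> [Vx|[y Vy E]]; first by exists x.
by rewrite -(tpK 1 x) -E tpK.
Qed.

Lemma MK_tp k l x : V l x -> V (l - k%:~R) (tp k x).
Proof.
elim/int_rect: k x => [|n IHn|n IHn] x.
- by rewrite tp0 subr0.
- move=> /IHn/MK_tau; rewrite -tpD -[n.+1%:Z]/(1 + n%:Z) intrD.
  by rewrite opprD addrA [l - 1 - _]addrAC.
- move=> /IHn; rewrite (MK_tau (l - (- n.+1%:Z)%:~R)) -tpD.
  have -> : 1 + - n.+1%:Z = - n%:Z by lia.
  suff -> : l - (- n.+1%:Z)%:~R - 1 = l - (- n%:Z)%:~R :> rat by [].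
  by rewrite -[n.+1%:Z]/(1 + n%:Z) !(intrD, intrN); ring.
Qed.

(** The vectors b i, multiplied by powers of tau, involve finitely many elements
    of a K[tau]-basis of V 0. These generate M after inverting tau, so there are
    no further basis elements: V 0 is finitely generated. *)
Lemma MK_bounded : exists l, V 0 `<=` below l.
Proof.
have [B [BV Bgen Bfree]] := mk_free MK 0.
have /choice[s Hs] : forall i, exists s : seq M, (forall y, y \in s -> B y) /\
    exists k, tau_span s (tp k%:Z (b i)).
  move=> i; have [k Vk] := mk_localisation MK 0 (b i).
  have [s [c [sB Ec]]] := Bgen _ Vk; exists s; split=> //.
  by exists k, c; rewrite -iter_tp.
pose s0 := undup (flatten [seq s i | i <- enum I]).
have us0 : uniq s0 by exact: undup_uniq.
have s0B y : y \in s0 -> B y.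
  by rewrite mem_undup => /flatten_mapP[i _]; exact: (Hs i).1.
have ss0 i y : y \in s i -> y \in s0.
  by rewrite mem_undup => yi; apply/flatten_mapP; exists i => //; exact: mem_enum.
have s0_all x : exists n : nat, tau_span s0 (tp n%:Z x).
  pose S := [set x | exists n : nat, tau_span s0 (tp n%:Z x)].
  apply: (espan_min (S := S)) (monomials_span x).
    split=> [|c y z [n Hn] [m Hm]].
      by exists 0%N; rewrite tp0; exact: (tau_span_subspace _).1.
    exists (n + m)%N; rewrite linearP; apply: (tau_span_subspace _).2.
      by rewrite addnC PoszD tpD; exact: tau_span_tau.
    by rewrite PoszD tpD; exact: tau_span_tau.
  move=> [i k] _ /=; have [_ [n [c Ec]]] := Hs i.
  exists (n + `|k|)%N; rewrite /monomial /= -tpD.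
  have -> : (n + `|k|)%N%:Z + k = (absz (`|k|%N%:Z + k))%:Z + n%:Z by lia.
  rewrite tpD; apply: tau_span_tau; rewrite Ec big_seq.
  apply: subspace_sum => [|y ys]; first exact: tau_span_subspace.
  by apply: tau_span_gen => //; exact: ss0 ys.
have Bs0 y : B y -> y \in s0.
  move=> By; apply/negPn/negP => ys; have [n [c Ec]] := s0_all y.
  pose c' z := if z == y then - 'X^n else c z.
  have us' : uniq (y :: s0) by rewrite /= ys.
  have HB : forall z, z \in y :: s0 -> B z by move=> z; rewrite inE => /predU1P[->|/s0B].
  have := Bfree _ c' us' HB _ _ (mem_head _ _); rewrite /c' eqxx => H.
  suff /H/eqP : \sum_(z <- y :: s0) tau_act (tp 1) (c' z) z = 0.
    by rewrite oppr_eq0 -size_poly_eq0 size_polyXn.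
  have EN : tau_act (tp 1) (- 'X^n : {poly K}) y = - tp n%:Z y.
    rewrite -[- 'X^n]scaleN1r -[_ *: 'X^n]addr0 tau_actD tau_actXn scaleN1r.
    by rewrite (@tau_actE 0) ?size_poly0 // big_ord0 addr0.
  rewrite big_cons /c' eqxx EN Ec addrC.
  apply/eqP; rewrite subr_eq0; apply/eqP; rewrite big_seq [RHS]big_seq.
  by apply: eq_bigr => z zs; case: eqP => // zy; rewrite zy (negPf ys) in zs.
have /choice[l Hl] : forall y, exists l, below l y by exact: below_exhaustive.
pose l0 := \sum_(y <- s0) `|l y|; exists l0 => x /Bgen[s1 [c [s1B ->]]].
rewrite big_seq; apply: subspace_sum => [|y /s1B/Bs0 ys]; first exact: below_subspace.
rewrite (@tau_actE (size (c y))) //.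
apply: subspace_sum => [|i _]; first exact: below_subspace.
apply: subspaceZ; first exact: below_subspace.
apply: (@belowS (l0 - i%:Z%:~R)); first by rewrite gerBl ler0z.
apply/tp_below; apply: belowS (Hl y); rewrite /l0 (bigD1_seq y) //=.
by rewrite (le_trans (ler_norm _)) // lerDl sumr_ge0.
Qed.

Lemma below_MK : exists r, forall l, below l `<=` V (l + r).
Proof.
have /choice[l Hl] : forall i, exists l, V l (b i) by move=> i; exact: (mk_exhaustive MK).
exists (\sum_i `|l i - lam i|) => l0.
apply: espan_min => [|[i k]]; first exact: MK_subspace.
rewrite /monomial_order /monomial /= => ikl.
apply: (mk_increasing MK) (MK_tp k (Hl i)).
rewrite (bigD1 i) //=; have := ler_norm (l i - lam i).
have : 0 <= \sum_(j | j != i) `|l j - lam j| by apply: sumr_ge0.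
lra.
Qed.

Lemma MK_below : exists r, forall l, V l `<=` below (l + r).
Proof.
have [k Vk] := MK_bounded; exists (k + 1) => l x Vx.
pose n := Num.floor l + 1.
have ln : l < n%:~R by exact: floorD1_gt.
have nl : n%:~R <= l + 1 by rewrite intrD lerD2r floor_le.
rewrite -(tpK n x); apply: (@belowS (k - (- n)%:~R)); first by rewrite intrN; lra.
apply/tp_below/Vk; rewrite -(subrr n%:~R).
by apply: MK_tp; apply: (mk_increasing MK) Vx; exact: ltW.
Qed.

(** Both filtrations are rewritten with indices in (1 / D) Z, where D clears the
    denominators of the jumps of V and of the orders lam i. *)
Lemma MK_unique l : V l = below l.
Proof.
have [A [_ HA]] := mk_jumps MK.
have [D D0 HD] := common_denominator (A ++ [seq lam i | i <- enum I]).
have DQ : 0 < D%:R :> rat by rewrite ltr0n.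
have jumpP x l0 : (exists z : int, x * D%:R = z%:~R) -> x <= l0 ->
    x <= level D (Num.floor (l0 * D%:R)).
  move=> [z Ez] xl; rewrite /level ler_pdivlMr // Ez ler_int floor_ge_int_tmp -Ez.
  by rewrite ler_pM2r.
have levelB m y : y < level D m -> level D (Num.floor (y * D%:R)) <= level D (m - 1).
  rewrite /level ltr_pdivlMr // -floor_lt_int => H.
  by rewrite ler_pM2r ?invr_gt0 // ler_int lerBrDr lezD1.
have floorV y : V y `<=` V (level D (Num.floor (y * D%:R))).
  have [y' [[a aA [z Ey']] y'y _ ->]] := HA y.
  apply: (mk_increasing MK); apply: jumpP => //.
  have [|z' Ez'] := HD a; first by rewrite mem_cat aA.
  exists (z' + z * D).
  by rewrite Ey' mulrDl Ez' intrD intrM.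
have orderD t : exists z : int, monomial_order t * D%:R = z%:~R.
  have [|z Ez] := HD (lam t.1); first by rewrite mem_cat map_f ?orbT // mem_enum.
  by exists (z - t.2 * D); rewrite mulrBl Ez intrB intrM.
have floorW y : below y `<=` below (level D (Num.floor (y * D%:R))).
  by apply: espanS => t; exact: jumpP.
have eV : eigen_filtration Euler_op D (fun m => V (level D m)).
  move=> m; split; first exact: MK_subspace.
    move=> x Vx; rewrite -[level D m](addrK 1).
    by apply: (MK_tau _ _).1; apply: (mk_dtau MK); exists x.
  have [n Hn] := mk_nilpotent MK (level D m); exists n => x /Hn[y ym Vy].
  by apply: (mk_increasing MK) (floorV _ _ Vy); exact: levelB.
have eW : eigen_filtration Euler_op D (fun m => below (level D m)).
  move=> m; split; first exact: below_subspace.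
    move=> x Wx; have := shifted_below 0 Wx.
    by rewrite /shifted /= scale0r addr0.
  exists 2 => x /shifted2_below; apply: espanS => t tm.
  have := levelB _ _ tm; apply: le_trans; exact: jumpP.
have [r1 H1] := below_MK; have [r2 H2] := MK_below.
(* one shift, counted in steps 1 / D, that serves for both inclusions *)
pose r := Num.bound ((`|r1| + `|r2|) * D%:R).
have levelD m : level D m + `|r1| + `|r2| <= level D (m + r%:Z).
  rewrite /level intrD mulrDl -addrA lerD2l ler_pdivlMr //; apply/ltW.
  by apply: archi_boundP; rewrite mulr_ge0 ?ler0n // addr_ge0.
apply/seteqP; split=> x.
  move=> /floorV Vx; apply: (@belowS (level D (Num.floor (l * D%:R)))).
    exact: level_floor.
  apply: (eigen_filtration_sub D0 (r := r) eV eW) Vx => m y /H2; apply: belowS.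
  by apply: le_trans (levelD m); have := ler_norm r2; have := normr_ge0 r1; lra.
move=> /floorW Wx; apply: (mk_increasing MK (level_floor D0 l)).
apply: (eigen_filtration_sub D0 (r := r) eW eV) Wx => m y /H1; apply: (mk_increasing MK).
by apply: le_trans (levelD m); have := ler_norm r1; have := normr_ge0 r2; lra.
Qed.

(** In coordinates, the numerator is spanned by the monomials (i, k) of order at
    most l with k <= 0, and the denominator by those among them with k < 0 or
    lam i < l. *)
Lemma gr_basis (G : set M) l : G = espan monomial (fun t => t.2 <= 0) ->
  basis_mod (gr_num V G l) (gr_den V G (tp (-1) @` G) l) [pred i | lam i == l] b.
Proof.
move=> EG.
have VG x l0 : V l0 x -> G x -> espan monomial (fun t => monomial_order t <= l0 /\ t.2 <= 0) x.
  by rewrite MK_unique EG; exact: espanI.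
have bE i : b i = monomial (i, 0) by rewrite /monomial /= tp0.
have tG : tp (-1) @` G = espan monomial (fun t => t.2 < 0).
  apply/seteqP; split=> [_ [x Gx <-]|x].
    move: x Gx; rewrite EG.
    apply: (espan_min (S := [set x | espan monomial (fun t => t.2 < 0) (tp (-1) x)])).
      by apply: subspace_tp; exact: espan_subspace.
    move=> [i k] /= k0; rewrite /monomial /= -tpD.
    by apply: (@espan_gen _ _ _ monomial _ (i, -1 + k)) => /=; lia.
  move=> Hx; exists (tp 1 x); last by rewrite -[in RHS](tpK 1 x).
  move: x Hx; rewrite EG.
  apply: (espan_min (S := [set x | espan monomial (fun t => t.2 <= 0) (tp 1 x)])).
    by apply: subspace_tp; exact: espan_subspace.
  move=> [i k] /= k0; rewrite /monomial /= -tpD.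
  by apply: (@espan_gen _ _ _ monomial _ (i, 1 + k)) => /=; lia.
have VtG_sub : subspace (V l `&` (tp (-1) @` G)).
  rewrite tG MK_unique; have [S0 SD] := below_subspace l.
  have [S0' SD'] := espan_subspace monomial (fun t => t.2 < 0).
  by split=> // a x y [? ?] [? ?]; split; [exact: SD|exact: SD'].
have ltG_sub : subspace (filt_lt V l `&` G).
  have [S0 SD] := espan_subspace monomial (fun t => t.2 <= 0); rewrite -EG in S0 SD.
  split.
    split=> //; exists (l - 1) => /=; first by lra.
    exact: (MK_subspace _).1.
  move=> a x y [[l1 /= l1l V1] Gx] [[l2 /= l2l V2] Gy]; split; last exact: SD.
  exists (Num.max l1 l2) => /=; first by rewrite gt_max l1l l2l.
  apply: (MK_subspace _).2.
    by apply: (mk_increasing MK) V1; rewrite le_max lexx.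
  by apply: (mk_increasing MK) V2; rewrite le_max lexx orbT.
have den_sub : subspace (gr_den V G (tp (-1) @` G) l).
  split; first by exists 0; [exact: VtG_sub.1|exists 0; [exact: ltG_sub.1|rewrite addr0]].
  move=> a _ _ [x Hx [y Hy <-]] [x' Hx' [y' Hy' <-]].
  exists (a *: x + x'); first exact: VtG_sub.2.
  exists (a *: y + y'); first exact: ltG_sub.2.
  by rewrite scalerDr addrACA.
split.
- move=> i /eqP <-; split; first rewrite MK_unique; rewrite ?EG bE; apply: espan_gen => //=.
  by rewrite /monomial_order /= subr0.
- move=> x [Vx Gx].
  pose S := [set x | exists c : I -> K,
    gr_den V G (tp (-1) @` G) l (x - \sum_(i | lam i == l) c i *: b i)].
  apply: (espan_min (S := S)) (VG _ _ Vx Gx).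
    split=> [|a y z [c Hc] [c' Hc']].
      exists (fun=> 0); rewrite big1 ?subr0 => [|i _]; first exact: den_sub.1.
      by rewrite scale0r.
    exists (fun i => a * c i + c' i).
    have -> : \sum_(i | lam i == l) (a * c i + c' i) *: b i =
        a *: (\sum_(i | lam i == l) c i *: b i) + \sum_(i | lam i == l) c' i *: b i.
      rewrite scaler_sumr -big_split; apply: eq_bigr => i _.
      by rewrite scalerDl scalerA.
    rewrite opprD addrACA -scalerBr; exact: den_sub.2.
  move=> [i k] [/= ikl k0].
  have Vm : V l (monomial (i, k)) by rewrite MK_unique; exact: espan_gen.
  have Gm : G (monomial (i, k)) by rewrite EG; exact: espan_gen.
  have [kn|kn] := ltP k 0.
    exists (fun=> 0); rewrite big1 ?subr0 => [|j _]; last by rewrite scale0r.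
    exists (monomial (i, k)); first by rewrite tG; split=> //; exact: espan_gen.
    by exists 0; [exact: ltG_sub.1|rewrite addr0].
  have {kn}k00 : k = 0 by lia.
  subst k; have := ikl; rewrite /monomial_order /= subr0 le_eqVlt => /predU1P[il|il].
    exists (fun j => (j == i)%:R); rewrite (bigD1 i) ?il //= eqxx scale1r -bE big1.
      by rewrite addr0 subrr; exact: den_sub.1.
    by move=> j /andP[_ /negPf->]; rewrite scale0r.
  exists (fun=> 0); rewrite big1 ?subr0 => [|j _]; last by rewrite scale0r.
  exists 0; first exact: VtG_sub.1.
  exists (monomial (i, 0)); last by rewrite add0r.
  split=> //; exists (lam i) => //=; rewrite MK_unique; apply: espan_gen.
  by rewrite /monomial_order /= subr0.
move=> c [y [_ Ty] [z [[l1 /= l1l V1] Gz] E]] i /= /eqP il.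
apply: (espan_neq monomials_indep (t := (i, 0))); set S := espan _ _.
have S_sub : subspace S by exact: espan_subspace.
have Sy : S y.
  by move: Ty; rewrite tG; apply: espanS => -[j k] /= k0 [_ kE]; rewrite kE ltxx in k0.
have Sz : S z.
  move: V1; rewrite MK_unique; apply: espanS => -[j k] /= + [jE kE].
  by rewrite jE kE /monomial_order /= subr0 il => /le_lt_trans/(_ l1l); rewrite ltxx.
have -> : c i *: monomial (i, 0) = (y + z) - \sum_(j | (lam j == l) && (j != i)) c j *: b j.
  by rewrite E (bigD1 i) ?il //= addrK bE.
apply: subspaceB => //; first exact: subspaceD.
apply: subspace_sum => // j /andP[_ ji]; apply: subspaceZ => //.
by rewrite bE; apply: espan_gen => -[jE]; rewrite jE eqxx in ji.
Qed.

End LatticeBasis.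

(** * Classes of forms in a fibre of the Gauss-Manin system *)

Section LaurentForms.
Variable K : fieldType.
Local Notation O := (mpoly 2 K).

Lemma laurent_sum (l : laurent K) : exists2 s : seq int,
  uniq s & (forall k, k \notin s -> lcoef k l = 0) /\
           l = \sum_(k <- s) lmono k (lcoef k l).
Proof.
exists (enum_fset (monalg.msupp l)); first exact: fset_uniq.
split=> [k kl|]; last exact: monalgE.
exact: mcoeff_outdom.
Qed.

Lemma lcoef_bound (l : laurent K) : exists B : int, forall k, B <= k -> lcoef k l = 0.
Proof.
have [s us [l0 _]] := laurent_sum l.
exists (\sum_(k <- s) `|k| + 1) => k Bk; apply: l0; apply: contraTN Bk => ks.
rewrite -ltNge ltzD1 (bigD1_seq k) //=.
by rewrite (le_trans (ler_norm _)) // lerDl sumr_ge0.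
Qed.

Lemma lmono_linear k : linear (@lmono K k).
Proof.
move=> a u v; apply/lcoefP => m.
rewrite linearP /= !lcoef_mono; case: eqP => // _.
by rewrite !mulr0n scaler0 addr0.
Qed.

HB.instance Definition _ k :=
  GRing.isLinear.Build K O (laurent K) *:%R (@lmono K k) (lmono_linear k).

Lemma ltau_mono m k (h : O) : ltau K m (lmono k h) = lmono (k + m) h.
Proof. by apply/lcoefP => n; rewrite lcoef_tau !lcoef_mono eq_sym subr_eq eq_sym. Qed.

Lemma rdiff_gM (g h : O) : rdiff g (h * g) = rdiff g h * g.
Proof. by rewrite /rdiff jacMl jacxx mulr0 add0r mulrC. Qed.

End LaurentForms.

Section FibreClasses.
Variables (K : numFieldType) (f g : mpoly 2 K) (t : K).
Local Notation O := (mpoly 2 K).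
Local Notation J := (jac f g).
Local Notation M := (gm_fibre f g t).
Local Notation tp := (gmf_tau f g t).
Local Notation dtau := (gmf_dtau f g t).

Definition fclass : {linear laurent K -> M} := gmf_class f g t \o gm_class f g.

Lemma fclass_surj (x : M) : exists l, x = fclass l.
Proof.
have [y ->] := cokproj_surj x; have [l ->] := cokproj_surj y.
by exists l.
Qed.

(** The fibre is a quotient of a quotient; this unfolds both. *)
Lemma fclass_eq0 l : fclass l = 0 <->
  exists u v, l = gmdiff f g u + (lmul g v - t *: v).
Proof.
have shiftE v : gm_shift f g t (gm_class f g v) = gm_class f g (lmul g v - t *: v).
  by rewrite gm_shiftE gm_tE [RHS]linearB [in RHS]linearZ.
have fE l' : fclass l' = gmf_class f g t (gm_class f g l') by [].
have quotE (V : lmodType K) (phi : {linear V -> V}) (x : V) :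
    cokproj phi x = 0 <-> exists y, x = phi y.
  rewrite -(linear0 (cokproj phi)); split=> [/cokproj_eq|[y ->]].
    by rewrite subr0 => /limageP.
  by apply/cokproj_eq; rewrite subr0; apply/limageP; exists y.
rewrite fE; split=> [/(quotE _ (gm_shift f g t))[y]|[u [v ->]]].
  have [v ->] := cokproj_surj y; rewrite -/(gm_class f g v) shiftE => E.
  have /(quotE _ (gmdiff f g))[u Eu] : gm_class f g (l - (lmul g v - t *: v)) = 0.
    by rewrite linearB E subrr.
  by exists u, v; rewrite -Eu subrK.
rewrite linearD -shiftE.
have -> : gm_class f g (gmdiff f g u) = 0 by apply/(quotE _ (gmdiff f g)); exists u.
by rewrite add0r; apply/(quotE _ (gm_shift f g t)); exists (gm_class f g v).
Qed.

Lemma tp_fclass k l : tp k (fclass l) = fclass (ltau K k l).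
Proof. by rewrite /fclass /= gmf_tauE gm_tauE. Qed.

Lemma dtau_fclass l : dtau (fclass l) = fclass (ldtauf f l).
Proof. by rewrite /fclass /= gmf_dtauE gm_dtauE. Qed.

Lemma gmf_tau0 x : tp 0 x = x.
Proof.
have [l ->] := fclass_surj x; rewrite tp_fclass; congr (fclass _).
by apply/lcoefP => k; rewrite lcoef_tau subr0.
Qed.

Lemma gmf_tauD k m x : tp (k + m) x = tp k (tp m x).
Proof.
have [l ->] := fclass_surj x; rewrite !tp_fclass; congr (fclass _).
by apply/lcoefP => n; rewrite !lcoef_tau opprD addrA.
Qed.

Lemma gmf_dtau_tau k x : dtau (tp k x) = tp k (dtau x) + k%:~R *: tp (k - 1) x.
Proof.
have [l ->] := fclass_surj x; rewrite !(tp_fclass, dtau_fclass) -linearZ -linearD.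
congr (fclass _); apply/lcoefP => n.
rewrite [RHS]linearD [in RHS]linearZ /= !(lcoef_tau, lcoef_dtauf).
have -> : n - (k - 1) = n + 1 - k by ring.
have -> : n - k + 1 = n + 1 - k by ring.
rewrite [RHS]addrAC -scalerDl -intrD; congr (_%:~R *: _ - _); ring.
Qed.

(** The class of tau^k h alpha. *)
Definition cform k (h : O) : M := fclass (lmono k h).

Lemma cform_is_linear k : linear (cform k).
Proof. by move=> a u v; rewrite /cform !linearP. Qed.

HB.instance Definition _ k :=
  GRing.isLinear.Build K O M *:%R (cform k) (cform_is_linear k).

Lemma tp_cform m k h : tp m (cform k h) = cform (k + m) h.
Proof. by rewrite /cform tp_fclass ltau_mono. Qed.

Lemma tp_cform0 m h : tp m (cform 0 h) = cform m h.
Proof. by rewrite tp_cform add0r. Qed.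

Lemma cform_mulg k h : cform k (h * g) = t *: cform k h.
Proof.
apply/eqP; rewrite -subr_eq0 -linearZ -linearB; apply/eqP/fclass_eq0.
exists 0, (lmono k h); rewrite linear0 add0r; apply/lcoefP => n.
rewrite [RHS]linearB [in RHS]linearZ /= lcoef_mul !lcoef_mono; case: eqP => _.
  by rewrite !mulr1n mulrC.
by rewrite !mulr0n mulr0 scaler0 subrr.
Qed.

(** The relation tau df h = dh of the Gauss-Manin system. *)
Lemma cform_mulJ k h : cform k (h * J) = cform (k - 1) (rdiff g h).
Proof.
apply/eqP; rewrite -subr_eq0 /cform -linearB; apply/eqP/fclass_eq0.
exists (lmono (k - 1) (- h)), 0; rewrite !linear0 !addr0; apply/lcoefP => n.
rewrite linearB /= lcoef_gmdiff !lcoef_mono (inj_eq (addIr _)).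
by do 2!case: eqP => _; rewrite ?mulr1n ?mulr0n ?mulr0 ?linear0 ?linearN /=; ring.
Qed.

Lemma Euler_cform k h :
  Euler_op tp dtau (cform k h) = k%:~R *: cform k h + cform (k + 1) (- f * h).
Proof.
rewrite /Euler_op /= dtau_fclass tp_fclass /cform -linearZ -linearD; congr (fclass _).
apply/lcoefP => n; rewrite [RHS]linearD [in RHS]linearZ /= lcoef_tau lcoef_dtauf !lcoef_mono.
rewrite subrK [k == n - 1]eq_sym subr_eq [n == k + 1]eq_sym mulNr mulNrn mulrnAr.
by case: eqP => [->|_] //; rewrite mulr0n !scaler0.
Qed.

Lemma brieskorn_fibre_sub (S : set M) : subspace S ->
  (forall k h, k <= 0 -> S (cform k h)) -> brieskorn_fibre f g t `<=` S.
Proof.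
move=> HS Sform _ [_ [l Hl <-] <-]; rewrite -[gmf_class _ _ _ _]/(fclass l).
have [s us [_ ->]] := laurent_sum l; rewrite linear_sum.
apply: subspace_sum => // k _; have [k0|k0] := lerP k 0.
  by apply: (Sform k (lcoef k l)); exact: k0.
by rewrite (Hl _ k0) linear0 linear0; exact: HS.1.
Qed.

Lemma forms_span (S : set M) : subspace S -> (forall k h, S (cform k h)) -> forall x, S x.
Proof.
move=> HS Sform x; have [l ->] := fclass_surj x.
have [s us [_ ->]] := laurent_sum l; rewrite linear_sum.
by apply: subspace_sum => // k _; exact: (Sform k (lcoef k l)).
Qed.

Lemma brieskorn_fibre_subspace : subspace (brieskorn_fibre f g t).
Proof.
split=> [|a _ _ [_ [l Hl <-] <-] [_ [l' Hl' <-] <-]].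
  exists 0; last by rewrite linear0.
  by exists 0; rewrite ?linear0 // => k _; rewrite linear0.
exists (gm_class f g (a *: l + l')); last by rewrite !linearP.
by exists (a *: l + l') => // k k0; rewrite linearP /= Hl // Hl' // scaler0 addr0.
Qed.

Lemma brieskorn_fibre_tp k x : k <= 0 ->
  brieskorn_fibre f g t x -> brieskorn_fibre f g t (tp k x).
Proof.
move=> k0 [_ [l Hl <-] <-]; exists (gm_class f g (ltau K k l)).
  by exists (ltau K k l) => // m m0; rewrite lcoef_tau Hl //; lia.
by rewrite gmf_tauE gm_tauE.
Qed.

Lemma brieskorn_fibre_form h : brieskorn_fibre f g t (cform 0 h).
Proof.
exists (gm_class f g (lmono 0 h)) => //; exists (lmono 0 h) => // k k0.
by rewrite lcoef_mono lt_eqF.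
Qed.

Lemma lcoef_relation k (u v : laurent K) :
  lcoef k (gmdiff f g u + (lmul g v - t *: v)) =
    rdiff g (lcoef k u) - J * lcoef (k - 1) u + (g - t%:MP) * lcoef k v.
Proof.
have lcoefD (a b : laurent K) : lcoef k (a + b) = lcoef k a + lcoef k b by exact: raddfD.
have lcoefB (a b : laurent K) : lcoef k (a - b) = lcoef k a - lcoef k b by exact: raddfB.
have lcoefZ a (b : laurent K) : lcoef k (a *: b) = a *: lcoef k b by exact: linearZ.
by rewrite lcoefD lcoef_gmdiff lcoefB lcoefZ lcoef_mul -mul_mpolyC [(g - _) * _]mulrBl.
Qed.

Lemma rdiff_fibreM q : rdiff g (q * (g - t%:MP)) = rdiff g q * (g - t%:MP).
Proof.
have rB (a b : O) : rdiff g (a - b) = rdiff g a - rdiff g b by exact: raddfB.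
have rZ (a : O) : rdiff g (t *: a) = t *: rdiff g a by exact: linearZ.
rewrite !mulrBr rB rdiff_gM; congr (_ - _).
by rewrite mulrC mul_mpolyC rZ -mul_mpolyC mulrC.
Qed.

End FibreClasses.

Section Independence.
Variables (K : numFieldType) (p : 'I_2 -> rat) (f g : mpoly 2 K) (t : K).
Hypothesis p_gt0 : forall i, 0 < p i.
Local Notation O := (mpoly 2 K).
Local Notation J := (jac f g).
Variables (e j : rat) (I : finType) (w : I -> O) (dw : I -> rat).
Hypotheses (e_gt0 : 0 < e) (Hg : whomog p e g) (HJ : whomog p j J) (J_neq0 : J != 0).
Hypothesis Hw : forall i, whomog p (dw i) (w i).
Hypothesis w_basis : basis_mod setT (ideal2 g J) predT w.
Variable B : I -> laurent K.
Hypothesis B_lead : forall i, lcoef 0 (B i) = w i.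
Hypothesis B_top : forall i k, 0 < k -> lcoef k (B i) = 0.

(** Let the relation be L = (d - tau df) u + (g - t) v. By descending induction
    on k, g - t divides u_k and all coefficients above k vanish: in degree k,
    sum_i c(i, k) w_i belongs to (J, g - t), so these coefficients vanish as
    well, and then regularity of (J, g - t) shows that g - t divides u_(k-1). *)
Lemma monomials_independent :
  independent (monomial (gmf_tau f g t) (fun i => fclass f g t (B i))).
Proof.
move=> s c us E.
pose c' x := if x \in s then c x else 0.
suff c'0 : forall x, c' x = 0 by move=> x xs; have := c'0 x; rewrite /c' xs.
pose L := \sum_(x <- s) c x *: ltau K x.2 (B x.1).
have /fclass_eq0[u [v EL]] : fclass f g t L = 0.
  rewrite -E /L linear_sum; apply: eq_bigr => x _.
  by rewrite linearZ /= /monomial tp_fclass.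
have [Bu HBu] := lcoef_bound u.
(* above B0 both u and the relation vanish *)
pose B0 := Num.max Bu (\sum_(x <- s) `|x.2|).
have lead k : (forall x, k < x.2 -> c' x = 0) -> lcoef k L = \sum_i c' (i, k) *: w i.
  move=> Hk; rewrite linear_sum big_seq (partition_big (fun x => x.1) xpredT) //=.
  apply: eq_bigr => i _; have [iks|iks] := boolP ((i, k) \in s); last first.
    rewrite /c' (negPf iks) scale0r big1 // => -[i' k'] /= /andP[xs /eqP ii].
    rewrite ii in xs *; rewrite linearZ /= lcoef_tau.
    have [kk|kk|kk] := ltgtP k k'.
    - by have := Hk (i, k') kk; rewrite /c' xs => ->; rewrite scale0r.
    - by rewrite B_top ?scaler0 // subr_gt0.
    - by rewrite -kk (negPf iks) in xs.
  rewrite -big_filter (bigD1_seq (i, k)) ?filter_uniq //=; last first.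
    by rewrite mem_filter iks /= eqxx.
  rewrite linearZ /= lcoef_tau subrr B_lead {1}/c' iks big_seq_cond big1 ?addr0 //.
  move=> [i' k'] /= /andP[]; rewrite mem_filter /= => /andP[/andP[xs /eqP ii] _] ne.
  rewrite ii in xs ne *; rewrite linearZ /= lcoef_tau.
  have [kk|kk|kk] := ltgtP k k'.
  - by have := Hk (i, k') kk; rewrite /c' xs => ->; rewrite scale0r.
  - by rewrite B_top ?scaler0 // subr_gt0.
  - by rewrite kk eqxx in ne.
have desc (n : nat) : mdivides (g - t%:MP) (lcoef (B0 - n%:Z) u) /\
    forall x, B0 - n%:Z < x.2 -> c' x = 0.
  elim: n => [|n [[q Eq] Hn]].
    rewrite subr0; split.
      by exists 0; rewrite mul0r HBu // /B0 le_max lexx.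
    move=> x; rewrite /c'; case: ifP => // xs; rewrite /B0 gt_max => /andP[_].
    rewrite (bigD1_seq x) //= ltNge => /negP[].
    by rewrite (le_trans (ler_norm _)) // lerDl sumr_ge0.
  set k := B0 - n%:Z in Eq Hn *.
  have Ek : \sum_i c' (i, k) *: w i =
      - lcoef (k - 1) u * J + (lcoef k v + rdiff g q) * (g - t%:MP).
    rewrite -(lead k Hn) EL lcoef_relation Eq rdiff_fibreM.
    by move: (rdiff g q) (lcoef _ u) (lcoef k v) J (g - _) => *; ring.
  have ck i : c' (i, k) = 0.
    exact: (deform_indep p_gt0 e_gt0 Hg HJ J_neq0 Hw w_basis Ek).
  have kS : B0 - n.+1%:Z = k - 1 by rewrite /k; lia.
  rewrite kS; split.
    apply: (deform_regular p_gt0 e_gt0 Hg HJ J_neq0 Hw w_basis (y := lcoef k v + rdiff g q)).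
    apply/eqP; rewrite -subr_eq0; apply/eqP.
    move: Ek; rewrite big1 => [E0|i _]; last by rewrite ck scale0r.
    by rewrite -[RHS]oppr0 [in RHS]E0; ring.
  move=> [i m] /= km; have [->|mk] := eqVneq m k; first exact: ck.
  by apply: Hn => /=; lia.
move=> [i k]; have [_] := desc (absz (B0 - k + 1)); apply => /=.
by clear; lia.
Qed.

End Independence.

(** * Jordan chains *)

Section Chains.
Variables (K : numFieldType) (p : 'I_2 -> rat) (e : rat) (f g : mpoly 2 K) (t : K).
Local Notation O := (mpoly 2 K).
Local Notation J := (jac f g).
Local Notation s := (p ord0 + p ord_max).
Local Notation tp := (gmf_tau f g t).
Local Notation dtau := (gmf_dtau f g t).
Local Notation cform := (cform f g t).
Local Notation T := (Euler_op tp dtau).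
Hypothesis p_gt0 : forall i, 0 < p i.
Hypotheses (e_gt0 : (0 : rat) < e) (Hf : whomog p 1 f) (Hg : whomog p e g).
Hypotheses (g_neq0 : g != 0) (J_neq0 : J != 0) (J_const : J@_0%MM = 0).
Hypothesis fg_colength : fin_colength p f g.
Variables (n : nat) (N : 'I_n -> nat) (h : 'I_n -> O) (hd : 'I_n -> rat).
Hypothesis Hh : forall i, whomog p (hd i) (h i).
Hypothesis jordan : jordan_basis p f g N h.

Local Notation I := {i : 'I_n & 'I_(N i).+1}.
Local Notation om i j := (omega f (h i) j).

Definition chain_pos (x : I) : nat := nat_of_ord (tagged x : 'I_(N (tag x)).+1).
Definition chain_form (x : I) : O := om (tag x) (chain_pos x).
Definition chain_deg (x : I) : rat := hd (tag x) + (chain_pos x)%:R.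

(** Defined for all j by adding degrees; it agrees with nu on the basis, whose
    forms are nonzero, and also makes sense past the end of a chain. *)
Definition chain_nu (i : 'I_n) (j : nat) : rat := hd i + j%:R + s - e.
Local Notation nux x := (chain_nu (tag x) (chain_pos x)).

Definition chain_index (i : 'I_n) (j : nat) : I :=
  Tagged (fun i => 'I_(N i).+1) (inord j : 'I_(N i).+1).

Let HJ : whomog p (1 + e - s) J. Proof. exact: whomog_jac. Qed.

Lemma om_homog i j : whomog p (hd i + j%:R) (om i j).
Proof.
rewrite /omega addrC; apply: whomogM => //.
by apply: whomogXn; exact: whomogN.
Qed.

Lemma omS i j : om i j.+1 = - f * om i j.
Proof. by rewrite /omega exprS mulrA. Qed.

Lemma chain_form_homog x : whomog p (chain_deg x) (chain_form x).
Proof. exact: om_homog. Qed.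

Let chain_basis : basis_mod setT (ideal2 g J) predT chain_form.
Proof. by case: jordan. Qed.

Lemma chain_form_index i j : (j <= N i)%N -> chain_form (chain_index i j) = om i j.
Proof. by move=> jN; rewrite /chain_form /chain_pos /= inordK. Qed.

Lemma om_neq0 i j : (j <= N i)%N -> om i j != 0.
Proof. by move=> jN; rewrite -chain_form_index //; exact: (basis_neq0 chain_basis). Qed.

Lemma chain_nuE i j : (j <= N i)%N -> nu p e (om i j) = chain_nu i j.
Proof.
move=> jN; rewrite /nu (wdegE (om_neq0 jN) (@om_homog i j)) /chain_nu.
by rewrite big_ord_recl big_ord1; congr (_ + (_ + p _) - _); exact: val_inj.
Qed.

Lemma chain_nu_le i j : (j <= N i)%N -> chain_nu i j <= 1 + e - s.
Proof.
move=> jN; rewrite leNgt; apply/negP => big.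
apply: (basis_notin chain_basis (i := chain_index i j)); rewrite chain_form_index //.
apply: (socle_degree p_gt0 Hg HJ _ J_const J_neq0 _ (@om_homog i j)).
- exact: whomog_gt0_coeff0 Hg.
- exact: (basis_fin_colength Hg HJ chain_basis).
- by move: big; rewrite /chain_nu; lra.
Qed.

Lemma f_om_ideal i j : (N i <= j)%N -> ideal2 g J (f * om i j).
Proof.
elim: j => [|j IHj]; rewrite ?leqn0 => Nj.
  by case: jordan => _ _ /(_ i); rewrite (eqP Nj).
move: Nj; rewrite leq_eqVlt => /predU1P[<-|/IHj].
  by case: jordan => _ _ /(_ i).
by rewrite omS mulNr mulrN => /(ideal2Ml (- f)); rewrite mulNr.
Qed.

Lemma ideal2_subspace (a b : O) : subspace (ideal2 a b).
Proof.
split; first by exists 0, 0; rewrite !mul0r addr0.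
move=> c x y Hx Hy; apply: ideal2D => //.
by rewrite -mul_mpolyC; exact: ideal2Ml.
Qed.

(** Up to sign, f takes each vector of a Jordan chain to its successor, and the
    last one to zero. *)
Lemma f_image (u : O) : exists2 c : I -> K, forall x, chain_pos x = 0%N -> c x = 0 &
  ideal2 g J (f * u - \sum_x c x *: chain_form x).
Proof.
pose S := [set y : O | exists2 c : I -> K, forall x, chain_pos x = 0%N -> c x = 0 &
  ideal2 g J (y - \sum_x c x *: chain_form x)].
have idS y : ideal2 g J y -> S y.
  move=> Hy; exists (fun=> 0) => //; rewrite big1 ?subr0 // => x _.
  by rewrite scale0r.
have HS : subspace S.
  split=> [|a x y [c c0 Hc] [c' c0' Hc']]; first by apply: idS; exact: (ideal2_subspace _ _).1.
  exists (fun z => a * c z + c' z); first by move=> z z0; rewrite c0 // c0' // mulr0 addr0.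
  have -> : \sum_z (a * c z + c' z) *: chain_form z =
      a *: (\sum_z c z *: chain_form z) + \sum_z c' z *: chain_form z.
    by rewrite scaler_sumr -big_split; apply: eq_bigr => z _; rewrite scalerDl scalerA.
  rewrite opprD addrACA -scalerBr; exact: (ideal2_subspace _ _).2.
rewrite -[exists2 _, _ & _]/(S (f * u)).
case: chain_basis => _ /(_ u Logic.I)[c Hc] _.
have -> : f * u = f * (u - \sum_x c x *: chain_form x) + \sum_x c x *: (f * chain_form x).
  rewrite mulrBr [X in _ - X]mulr_sumr.
  by under [X in _ - X]eq_bigr => x _ do rewrite -scalerAr; rewrite subrK.
apply: subspaceD => //; first by apply: idS; exact: ideal2Ml.
apply: subspace_sum => // -[i j] _; apply: subspaceZ => //; rewrite /chain_form /=.
have [jN|jN] := ltnP j (N i); last by apply: idS; exact: f_om_ideal.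
exists (fun x => - (x == chain_index i j.+1)%:R).
  move=> x x0; case: eqP => [E|_]; last by rewrite oppr0.
  by move: x0; rewrite E /chain_pos /= inordK.
rewrite (bigD1 (chain_index i j.+1)) //= eqxx.
rewrite big1 => [|x /negPf ->]; last by rewrite oppr0 scale0r.
rewrite addr0 chain_form_index // scaleN1r opprK omS mulNr subrr.
exact: (ideal2_subspace _ _).1.
Qed.

(** Otherwise the socle degree of (f, g) puts the initial form of the chain into
    (f, g), hence, modulo (g, J), into the image of f. *)
Lemma chain_nu0_le1 i : chain_nu i 0 <= 1.
Proof.
rewrite leNgt; apply/negP => big.
have [u [v E]] : ideal2 f g (om i 0).
  apply: (socle_degree p_gt0 Hf Hg _ _ g_neq0 fg_colength (@om_homog i 0)).
  - exact: whomog_gt0_coeff0 Hf.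
  - exact: whomog_gt0_coeff0 Hg.
  - by move: big; rewrite /chain_nu; lra.
have [c c0 Hc] := f_image u.
pose c1 x := (x == chain_index i 0)%:R - c x.
have := basis_indep chain_basis (c := c1) _ (chain_index i 0); rewrite /c1.
rewrite eqxx c0 ?subr0 => [H|]; last by rewrite /chain_pos /= inordK.
suff /H/eqP : ideal2 g J (\sum_x ((x == chain_index i 0)%:R - c x) *: chain_form x).
  by rewrite oner_eq0.
under eq_bigr => x _ do rewrite scalerBl.
rewrite sumrB (bigD1 (chain_index i 0)) //= eqxx scale1r.
rewrite big1 ?addr0 => [|x /negPf ->]; last by rewrite scale0r.
rewrite chain_form_index // E.
have -> : u * f + v * g - \sum_x c x *: chain_form x =
    (f * u - \sum_x c x *: chain_form x) + v * g.
  by rewrite [u * f]mulrC addrAC.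
by apply: ideal2D => //; exists v, 0; rewrite mul0r addr0.
Qed.

Definition tilde (x : I) : gm_fibre f g t :=
  gmf_class f g t (omega_tilde p e f g (h (tag x)) (chain_pos x)).
Definition chain_lambda (x : I) : rat := lambda p e f (h (tag x)) (chain_pos x).
Local Notation Wle := (below tp tilde chain_lambda).
Local Notation Wlt := (strictly_below tp tilde chain_lambda).

(** A representative of omega_tilde in powers of tau at most 0, whose
    coefficient at tau^0 is the Jordan form itself. *)
Definition tilde_lift (x : I) : laurent K :=
  if 1 < nux x then
    lmono 0 (chain_form x) + ratr (nux x - 1) *: lmono (-1) (om (tag x) (chain_pos x).-1)
  else lmono 0 (chain_form x).

Lemma chain_pos_le (x : I) : (chain_pos x <= N (tag x))%N.
Proof. by rewrite -ltnS ltn_ord. Qed.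

Lemma tilde_class x : tilde x = fclass f g t (tilde_lift x).
Proof.
rewrite /tilde /omega_tilde chain_nuE ?chain_pos_le // /tilde_lift; case: ifP => // _.
rewrite !linearD; congr (_ + _); rewrite !linearZ /=; congr (_ *: _).
rewrite -gmf_tauE -[gmf_class _ _ _ _]/(cform 0 _) tp_cform; congr (cform _ _).
Qed.

Lemma tilde_big x : 1 < nux x ->
  tilde x = cform 0 (chain_form x) +
    ratr (nux x - 1) *: cform (-1) (om (tag x) (chain_pos x).-1).
Proof. by move=> big; rewrite tilde_class /tilde_lift big linearD linearZ. Qed.

Lemma tilde_small x : nux x <= 1 -> tilde x = cform 0 (chain_form x).
Proof. by rewrite tilde_class /tilde_lift leNgt => /negPf ->. Qed.

Lemma chain_lambdaE x : chain_lambda x = let v := nux x in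
  if 1 < v then 1 else if 0 <= v then v else 0.
Proof. by rewrite /chain_lambda /lambda chain_nuE ?chain_pos_le. Qed.

Lemma chain_pos_gt0 x : 1 < nux x -> (0 < chain_pos x)%N.
Proof.
rewrite lt0n; apply: contraTneq => E; rewrite -leNgt.
by have := chain_nu0_le1 (tag x); rewrite /chain_nu E.
Qed.

Lemma tilde_independent : independent (monomial tp tilde).
Proof.
have -> : tilde = fun x => fclass f g t (tilde_lift x) by apply/funext; exact: tilde_class.
apply: (monomials_independent (B := tilde_lift) p_gt0 e_gt0 Hg HJ J_neq0
  chain_form_homog chain_basis _ _).
  move=> x; rewrite /tilde_lift; case: ifP => _; rewrite ?linearD ?linearZ /= !lcoef_mono //.
  by rewrite scaler0 addr0.
move=> x k k0; have k0' : (0 == k) = false by rewrite lt_eqF.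
have k1 : (-1 == k) = false by apply/negP => /eqP E; rewrite -E in k0.
rewrite /tilde_lift; case: ifP => _; rewrite ?linearD ?linearZ /= !lcoef_mono k0' ?k1 //.
by rewrite scaler0 addr0.
Qed.

(** Spanned by elements of G_t of bounded order: keeping both conditions proves
    at once that G_t is generated by the omega_tilde and the estimate of
    orders. *)
Definition lattice (l : rat) : set (gm_fibre f g t) :=
  espan (monomial tp tilde) (fun x => monomial_order chain_lambda x <= l /\ x.2 <= 0).

Lemma lattice_subspace l : subspace (lattice l). Proof. exact: espan_subspace. Qed.

Lemma latticeS l l' : l <= l' -> lattice l `<=` lattice l'.
Proof. by move=> ll'; apply: espanS => x [/le_trans H ?]; split=> //; exact: H. Qed.

Lemma lattice_below l : lattice l `<=` Wle l.
Proof. by apply: espanS => x []. Qed.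

Lemma lattice_theta l x : lattice l x -> lattice (l + 1) (tp (-1) x).
Proof.
move: x; apply: (espan_min (S := [set x | lattice (l + 1) (tp (-1) x)])).
  by apply: subspace_tp; exact: lattice_subspace.
move=> [i k] [/= ikl k0]; rewrite /monomial /= -gmf_tauD.
apply: (@espan_gen _ _ _ (monomial tp tilde) _ (i, -1 + k)); split=> /=; last by lia.
by move: ikl; rewrite /monomial_order /= intrD intrN; lra.
Qed.

Lemma lattice_tilde x l : chain_lambda x <= l -> lattice l (tilde x).
Proof.
move=> xl; have -> : tilde x = monomial tp tilde (x, 0) by rewrite /monomial /= gmf_tau0.
by apply: espan_gen; split=> //; rewrite /monomial_order /= subr0.
Qed.

(** Induction on the degree. In the decomposition of y over the Jordan basis,
    u has degree smaller by e and dv has degree smaller by 1, and a Jordan form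
    with nu > 1 differs from its omega_tilde by tau^-1 times its
    predecessor. *)
Lemma cform_order d y : whomog p d y -> lattice (Num.max (d + s - e) 0) (cform 0 y).
Proof.
pose del := Num.min 1 e; have del0 : 0 < del by rewrite lt_min ltr01.
have [del1 dele] : del <= 1 /\ del <= e by rewrite !ge_min !lexx orbT.
have [m dm] := archi_mul d del0.
elim: m => [|m IHm] in d y dm *; move=> Hy.
  rewrite mul0r in dm; rewrite (whomog_lt0 p_gt0 dm Hy) linear0.
  exact: (lattice_subspace _).1.
rewrite mulrSr mulrDl mul1r in dm.
have [c [u [v [-> cd Hu Hv]]]] := basis_hom_decomp Hg HJ chain_form_homog chain_basis Hy.
rewrite !linearD /= cform_mulg cform_mulJ.
apply: subspaceD (lattice_subspace _) _ _.
  apply: subspaceD (lattice_subspace _) _ _.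
    rewrite linear_sum; apply: subspace_sum (lattice_subspace _) _ => x _.
    rewrite linearZ /=; have [->|/eqP cx] := eqVneq (c x) 0.
      by rewrite scale0r; exact: (lattice_subspace _).1.
    have xd : chain_deg x = d by apply/eqP/negPn/negP => /cd.
    apply: subspaceZ (lattice_subspace _) _.
    have nx : nux x = d + s - e by rewrite -xd /chain_deg /chain_nu addrA.
    have [small|big] := leP (nux x) 1.
      rewrite -tilde_small //; apply: lattice_tilde.
      rewrite chain_lambdaE /= ltNge small /= nx.
      by case: ifP => _; rewrite le_max lexx ?orbT.
    have -> : cform 0 (chain_form x) = tilde x -
        ratr (nux x - 1) *: tp (-1) (cform 0 (om (tag x) (chain_pos x).-1)).
      by rewrite (tilde_big big) tp_cform0 addrK.
    rewrite -nx max_l; last by lra.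
    apply: subspaceB (lattice_subspace _) _ _.
      by apply: lattice_tilde; rewrite chain_lambdaE /= big ltW.
    apply: subspaceZ (lattice_subspace _) _.
    have posx := chain_pos_gt0 big.
    have E : hd (tag x) + (chain_pos x).-1%:R = d - 1.
      by rewrite -xd /chain_deg -[in RHS](prednK posx) -natr1; ring.
    have Hom := @om_homog (tag x) (chain_pos x).-1; rewrite E in Hom.
    have := lattice_theta (IHm _ _ _ Hom); rewrite max_l; last by lra.
    by rewrite (_ : _ + 1 = d + s - e); [rewrite nx; apply; lra|ring].
  apply: subspaceZ (lattice_subspace _) _.
  apply: (@latticeS (Num.max (d - e + s - e) 0)).
    by rewrite ge_max !le_max lexx orbT andbT; apply/orP; left; lra.
  by apply: IHm Hu; lra.
rewrite add0r -tp_cform0.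
have [small|big] := ltP (d - (1 + e - s)) 0.
  rewrite (whomog_lt0 p_gt0 small Hv) !linear0; exact: (lattice_subspace _).1.
have HJv := whomog_jac Hv Hg.
apply: (@latticeS (Num.max (d - 1 + s - e) 0 + 1)).
  by rewrite max_l ?le_max; lra.
apply: lattice_theta; apply: IHm; first by lra.
suff <- : d - (1 + e - s) + e - s = d - 1 by [].
ring.
Qed.

Lemma cform_below d l y : whomog p d y -> d + s - e <= l -> 0 <= l ->
  Wle l (cform 0 y).
Proof.
move=> Hy dl l0; apply/lattice_below/(@latticeS (Num.max (d + s - e) 0)).
  by rewrite ge_max dl l0.
exact: cform_order.
Qed.

Lemma cform_strictly_below d l y : whomog p d y -> d + s - e < l -> 0 < l ->
  Wlt l (cform 0 y).
Proof.
move=> Hy dl l0; apply: (@below_strictly _ _ _ _ _ _ (Num.max (d + s - e) 0)).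
  by rewrite gt_max dl l0.
by apply: (cform_below Hy); rewrite le_max lexx ?orbT.
Qed.

Lemma lattice_cform k y : k <= 0 ->
  espan (monomial tp tilde) (fun x => x.2 <= 0) (cform k y).
Proof.
move=> k0; rewrite -tp_cform0.
have S_sub := espan_subspace (monomial tp tilde) (fun x => x.2 <= 0).
suff : espan (monomial tp tilde) (fun x => x.2 <= 0) (cform 0 y).
  apply: (espan_min (S := [set z | espan (monomial tp tilde) (fun x => x.2 <= 0) (tp k z)])).
    exact: subspace_tp.
  move=> [i m] /= m0; rewrite /monomial /= -gmf_tauD.
  by apply: (@espan_gen _ _ _ (monomial tp tilde) _ (i, k + m)) => /=; lia.
apply: (@hcomp_ind K p (fun y => espan (monomial tp tilde) (fun x => x.2 <= 0) (cform 0 y))).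
- by rewrite linear0; exact: S_sub.1.
- by move=> a b Ha Hb; rewrite linearD; exact: subspaceD.
move=> d; have := cform_order (whomog_hcomp p d y).
by apply: espanS => x [].
Qed.

Lemma tilde_span z : espan (monomial tp tilde) (fun=> True) z.
Proof.
have S_sub := espan_subspace (monomial tp tilde) (fun=> True).
move: z; apply: forms_span => // k y; rewrite -tp_cform0.
have : espan (monomial tp tilde) (fun x => x.2 <= 0) (cform 0 y) by exact: lattice_cform.
apply: (espan_min (S := [set z | espan (monomial tp tilde) (fun=> True) (tp k z)])).
  exact: subspace_tp.
move=> [i m] _; rewrite /= /monomial /= -gmf_tauD.
exact: (@espan_gen _ _ _ (monomial tp tilde) _ (i, k + m)).
Qed.

Lemma brieskorn_fibre_tilde :
  brieskorn_fibre f g t = espan (monomial tp tilde) (fun x => x.2 <= 0).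
Proof.
have G_sub := brieskorn_fibre_subspace f g t.
apply/seteqP; split.
  apply: brieskorn_fibre_sub => [|k y k0]; [exact: espan_subspace|exact: lattice_cform].
apply: espan_min => // -[x k] /= k0; apply: brieskorn_fibre_tp => //=.
have Gth y : brieskorn_fibre f g t (cform (-1) y).
  by rewrite -tp_cform0; apply: brieskorn_fibre_tp => //; exact: brieskorn_fibre_form.
have [small|big] := leP (nux x) 1.
  by rewrite tilde_small //; exact: brieskorn_fibre_form.
rewrite (tilde_big big); apply: subspaceD => //; first exact: brieskorn_fibre_form.
exact: subspaceZ.
Qed.

(** (tau d/dtau + v) [y] = tau (next_form y v), and next_form takes omega^j to
    omega_tilde^(j+1) when v = nu(omega^j) > 0. *)
Definition next_form (y : O) (v : rat) := cform 0 (- f * y) + ratr v *: cform (-1) y.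

(** From - f y = a g + b J, Euler's formula gives f (db + v y) in (g), hence
    db + v y = q g and next_form y v = t ([a] + tau^-1 [q]). With respect to
    - f y, the degrees of a and q are smaller by e and by e + 1, which
    suffices in view of the bound on v. *)
Lemma next_form_end d y : whomog p d y -> ideal2 g J (f * y) ->
  let v := d + s - e in 0 < v -> v <= 1 \/ v <= 1 + e - s ->
  Wlt (Num.min v 1 + 1) (next_form y v).
Proof.
move=> Hy Iy v v0 v_le.
have HfY : whomog p (1 + d) (- f * y) by apply: whomogM => //; exact: whomogN.
have IfY : ideal2 g J (- f * y).
  by rewrite mulNr -mulN1r; exact: ideal2Ml.
have [a [b [Ha Hb E]]] := ideal2_hom Hg HJ HfY IfY.
have Ev : 1 + d - (1 + e - s) = v by rewrite /v; ring.
rewrite Ev in Hb.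
have euler2 (q : O) c : whomog p c q ->
    ratr (p ord0) *: ('X_ord0 * q^`M(ord0)) +
      ratr (p ord_max) *: ('X_ord_max * q^`M(ord_max)) = ratr c *: q.
  move=> /whomog_euler <-; rewrite big_ord_recl big_ord1.
  by congr (_ + ratr (p _) *: ('X_ _ * q^`M(_))); exact: val_inj.
(* Euler's formula for b, f and g in J(f, g) E(b) = E(f) J(b, g) + E(g) J(f, b) *)
have key : ratr v *: (b * J) = f * jac b g + ratr e *: (g * jac f b).
  have -> : ratr v *: (b * J) = (ratr v *: b) * J by rewrite scalerAl.
  have -> : f * jac b g = (ratr 1 *: f) * jac b g by rewrite rmorph1 scale1r.
  have -> : ratr e *: (g * jac f b) = (ratr e *: g) * jac f b by rewrite scalerAl.
  rewrite -(euler2 _ _ Hb) -(euler2 _ _ Hf) -(euler2 _ _ Hg) /jac -!mul_mpolyC; ring.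
have key2 : f * (jac b g + ratr v *: y) = g * - (ratr v *: a + ratr e *: jac f b).
  have : ratr v *: (- f * y) = ratr v *: (a * g) + ratr v *: (b * J).
    by rewrite E scalerDr.
  rewrite key -!mul_mpolyC => E'.
  apply/eqP; rewrite -subr_eq0; apply/eqP.
  move/eqP: E'; rewrite -subr_eq0 => /eqP E'; rewrite -[RHS]oppr0 -[in RHS]E'; ring.
have [q0 Eq0] : mdivides g (jac b g + ratr v *: y).
  exact: (fin_colength_regular p_gt0 g_neq0 fg_colength key2).
pose q := hcomp p (d - e) q0.
have Hbg : whomog p d (jac b g).
  by have := whomog_jac Hb Hg; rewrite (_ : v + e - s = d) // /v; ring.
have Eq : jac b g + ratr v *: y = q * g.
  rewrite -(hcompMr _ _ Hg) -Eq0 hcomp_id //; apply: whomogD => //; exact: whomogZ.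
have -> : next_form y v = t *: (cform 0 a + cform (-1) q).
  rewrite /next_form E linearD /= cform_mulg cform_mulJ sub0r -addrA.
  have -> : cform (-1) (rdiff g b) + ratr v *: cform (-1) y = cform (-1) (q * g).
    by rewrite -Eq [jac b g + _]addrC linearP addrC.
  by rewrite cform_mulg scalerDr.
apply: subspaceZ; first exact: strictly_below_subspace.
apply: subspaceD; first exact: strictly_below_subspace.
  apply: cform_strictly_below Ha _ _; rewrite ?addr_gt0 // ?lt_min ?v0 //.
  have lt_v : 1 + d - e + s - e - 1 < v by move: e_gt0; rewrite /v; lra.
  have lt_1 : 1 + d - e + s - e - 1 < 1.
    by move: e_gt0 (p_gt0 ord0) (p_gt0 ord_max); case: v_le; rewrite /v; lra.
  by rewrite -ltrBlDr lt_min lt_v.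
rewrite -tp_cform0.
have -> : Num.min v 1 + 1 = Num.min v 1 - (-1)%:~R by rewrite intrN opprK.
apply: tp_strictly_below; first exact: gmf_tauD.
apply: cform_strictly_below (whomog_hcomp p _ _) _ _; rewrite ?lt_min ?v0 //.
have lt_v : d - e + s - e < v by move: e_gt0; rewrite /v; lra.
have lt_1 : d - e + s - e < 1.
    by move: e_gt0 (p_gt0 ord0) (p_gt0 ord_max); case: v_le; rewrite /v; lra.
by rewrite lt_v.
Qed.

(** Inside the chain the next vector of the basis is available; from its last
    vector on, f maps into (g, J). *)
Lemma next_form_bound i j : 0 < chain_nu i j -> (j <= N i)%N \/ chain_nu i j <= 1 ->
  Wlt (Num.min (chain_nu i j) 1 + 1) (next_form (om i j) (chain_nu i j)).
Proof.
move=> v0 jN; have [jNi|Nij] := ltnP j (N i).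
  have Ev : chain_nu i j.+1 = chain_nu i j + 1 by rewrite /chain_nu -natr1; ring.
  have posE : chain_pos (chain_index i j.+1) = j.+1 by rewrite /chain_pos /= inordK.
  have big : 1 < chain_nu (tag (chain_index i j.+1)) (chain_pos (chain_index i j.+1)).
    by rewrite posE -[chain_nu _ _]/(chain_nu i j.+1) Ev; lra.
  have btE : tilde (chain_index i j.+1) = cform 0 (chain_form (chain_index i j.+1)) +
      ratr (chain_nu i (chain_pos (chain_index i j.+1)) - 1) *:
        cform (-1) (om i (chain_pos (chain_index i j.+1)).-1).
    exact: tilde_big big.
  rewrite posE chain_form_index // omS Ev [_ + 1 - 1]addrK [j.+1.-1]/= in btE.
  rewrite /next_form -btE.
  apply: (@below_strictly _ _ _ _ _ _ 1); first by rewrite ltrDr lt_min v0 ltr01.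
  by apply/lattice_below/lattice_tilde; rewrite chain_lambdaE /= big.
apply: next_form_end => //; first exact: om_homog.
  exact: f_om_ideal.
by case: jN => [/chain_nu_le|]; [right|left].
Qed.

Lemma Euler_cform0 y : T (cform 0 y) = cform 1 (- f * y).
Proof. by rewrite Euler_cform scale0r !add0r. Qed.

Lemma Euler_next_form y v : T (cform 0 y) + ratr v *: cform 0 y = tp 1 (next_form y v).
Proof.
have tpP a b : tp 1 (a + ratr v *: b) = tp 1 a + ratr v *: tp 1 b.
  by rewrite addrC linearP addrC.
by rewrite Euler_cform0 /next_form tpP !tp_cform add0r addNr.
Qed.

Lemma Euler_cform_ratr0 y : T (cform 0 y) + ratr 0 *: cform 0 y = tp 1 (cform 0 (- f * y)).
Proof. by rewrite Euler_cform0 rmorph0 scale0r addr0 tp_cform0. Qed.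

Lemma Euler_tp1_ratr0 z : T (tp 1 z) + ratr 0 *: tp 1 z = tp 1 (T z + ratr 1 *: z).
Proof.
rewrite (Euler_tp (gmf_tauD (t := t)) (gmf_dtau_tau (t := t))).
have -> : ratr 0 = 0 :> K by exact: rmorph0.
have -> : ratr 1 = 1%:~R :> K by exact: rmorph1.
by rewrite [X in _ + X]scale0r [LHS]addr0.
Qed.

Lemma tp1_strictly_below l z : Wlt (l + 1) z ->
  Wlt l (tp 1 z).
Proof.
by move/(tp_strictly_below (gmf_tauD (t := t)) 1); rewrite addrK.
Qed.

Lemma tp1_below l z : Wle (l + 1) z -> Wle l (tp 1 z).
Proof. by move/(tp_below (gmf_tauD (t := t)) 1); rewrite addrK. Qed.

(** The order strictly drops except for nu = 0: there the result is
    tau [omega^(j+1)], of order at most 0 because nu(omega^(j+1)) = 1. *)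
Lemma Euler_tilde x : let y := T (tilde x) + ratr (chain_lambda x) *: tilde x in
  (nux x != 0 -> Wlt (chain_lambda x) y) /\
  (nux x = 0 -> y = tp 1 (cform 0 (- f * chain_form x))).
Proof.
move=> y; rewrite {}/y; have lamx := chain_lambdaE x; rewrite /= in lamx.
set v := nux x in lamx *.
have vE : hd (tag x) + (chain_pos x)%:R + s - e = v by [].
have HwS : whomog p (1 + chain_deg x) (- f * chain_form x).
  by apply: whomogM; [exact: whomogN|exact: chain_form_homog].
have dwE : 1 + chain_deg x + s - e = v + 1 by rewrite -vE /chain_deg; ring.
have [big|small] := ltP 1 v.
  have nz : v != 0 by rewrite gt_eqF //; lra.
  split=> [_|/eqP]; last by rewrite (negPf nz).
  rewrite big in lamx; rewrite lamx rmorph1 scale1r.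
  suff -> : T (tilde x) + tilde x = tp 1 (next_form (chain_form x) v).
    apply: tp1_strictly_below; have := @next_form_bound (tag x) (chain_pos x).
    rewrite -/v min_r ?(ltW big) //; apply; first by lra.
    by left; exact: chain_pos_le.
  have omE : - f * om (tag x) (chain_pos x).-1 = chain_form x.
    by rewrite -omS (prednK (chain_pos_gt0 big)).
  have T2 : T (cform (-1) (om (tag x) (chain_pos x).-1)) =
      cform 0 (chain_form x) - cform (-1) (om (tag x) (chain_pos x).-1).
    by rewrite Euler_cform omE addNr intrN scaleN1r addrC.
  have TD a b r : T (a + r *: b) = T a + r *: T b by rewrite linearD linearZ.
  rewrite -Euler_next_form (tilde_big big) -/v TD T2 -addrA; congr (_ + _).
  have -> : ratr v = ratr (v - 1) + 1 :> K.
    by move: (v) => v'; rewrite rmorphB rmorph1 /= subrK.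
  by rewrite scalerBr addrACA addNr addr0 scalerDl scale1r.
have -> : tilde x = cform 0 (chain_form x) by apply: tilde_small.
rewrite ltNge small /= in lamx.
have [vneg|vpos|v0] := ltgtP v 0.
- rewrite leNgt vneg /= in lamx; split=> [_|v0]; last by rewrite v0 ltxx in vneg.
  rewrite lamx Euler_cform_ratr0; apply: tp1_strictly_below.
  apply: cform_strictly_below HwS _ _; first by rewrite dwE; lra.
  by rewrite add0r ltr01.
- rewrite (ltW vpos) in lamx; split=> [_|v0]; last by rewrite v0 ltxx in vpos.
  rewrite lamx Euler_next_form; apply: tp1_strictly_below.
  have := @next_form_bound (tag x) (chain_pos x); rewrite -/v min_l //; apply=> //.
  by right.
rewrite v0 lexx in lamx; split=> [/negP[] //|_].
by rewrite lamx Euler_cform_ratr0.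
Qed.

Lemma chain_lambda_nu0 x : nux x = 0 -> chain_lambda x = 0.
Proof. by move=> v0; rewrite chain_lambdaE /= v0 lexx ltNge ler01. Qed.

Lemma Euler_tilde_below x :
  Wle (chain_lambda x) (T (tilde x) + ratr (chain_lambda x) *: tilde x).
Proof.
have [H nz] := Euler_tilde x.
have [v0|/H] := eqVneq (nux x) 0; last exact: strictly_belowW.
rewrite (nz v0) (chain_lambda_nu0 v0); apply: tp1_below.
have HwS : whomog p (1 + chain_deg x) (- f * chain_form x).
  by apply: whomogM; [exact: whomogN|exact: chain_form_homog].
apply: cform_below HwS _ _; last by rewrite add0r ler01.
have -> : 1 + chain_deg x + s - e = nux x + 1 by rewrite /chain_nu /chain_deg; ring.
by rewrite v0.
Qed.

(** For nu = 0 the second application produces tau^2 times the next form of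
    omega^(j+1), whose order is smaller than 2. *)
Lemma Euler2_tilde_below x : let y := T (tilde x) + ratr (chain_lambda x) *: tilde x in
  Wlt (chain_lambda x) (T y + ratr (chain_lambda x) *: y).
Proof.
move=> y; have [H nz] : (nux x != 0 -> Wlt (chain_lambda x) y) /\
  (nux x = 0 -> y = tp 1 (cform 0 (- f * chain_form x))) := Euler_tilde x.
clearbody y.
have [v0|/H Hy] := eqVneq (nux x) 0; last first.
  exact: (shifted_strictly_below (gmf_tauD (t := t)) (gmf_dtau_tau (t := t))
    Euler_tilde_below (ratr (chain_lambda x)) Hy).
rewrite (nz v0) (chain_lambda_nu0 v0) Euler_tp1_ratr0.
have E1 : chain_nu (tag x) (chain_pos x).+1 = 1.
  by rewrite -[1]add0r -v0 /chain_nu -natr1; ring.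
rewrite -[- f * chain_form x]omS Euler_next_form.
apply: tp1_strictly_below; apply: tp1_strictly_below.
have := @next_form_bound (tag x) (chain_pos x).+1; rewrite E1 minxx add0r.
by apply; [exact: ltr01|right].
Qed.

Lemma gr_basis_chains (V : rat -> set (gm_fibre f g t)) l :
  malgrange_kashiwara (tp 1) dtau V ->
  basis_mod (gr_num V (brieskorn_fibre f g t) l)
    (gr_den V (brieskorn_fibre f g t) (tp (-1) @` brieskorn_fibre f g t) l)
    [pred x | chain_lambda x == l] tilde.
Proof.
move=> MK.
exact: (gr_basis (gmf_tau0 (t := t)) (gmf_tauD (t := t)) (gmf_dtau_tau (t := t))
  tilde_span tilde_independent Euler_tilde_below Euler2_tilde_below MK l
  brieskorn_fibre_tilde).
Qed.

End Chains.

(** * The basis of the graded pieces *)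

Lemma whomog_nonunit_gt0 (K : numFieldType) (p : 'I_2 -> rat) e (g : mpoly 2 K) :
  (forall i, 0 < p i) -> whomog p e g -> g != 0 -> g \isn't a GRing.unit -> 0 < e.
Proof.
move=> p_gt0 Hg g0 gU; rewrite ltNge; apply: contra gU; rewrite le_eqVlt.
move=> /predU1P[E|elt]; last by rewrite (whomog_lt0 p_gt0 elt Hg) eqxx in g0.
rewrite E in Hg; rewrite (whomog_deg0 p_gt0 Hg) in g0 *.
by rewrite rmorph_unit // unitfE; apply: contraNneq g0 => ->.
Qed.

(** The Jacobian is homogeneous: unless its degree is positive it is constant, and
    it vanishes at the singular point. *)
Lemma singular_jac_const (K : numFieldType) (p : 'I_2 -> rat) e (f g : mpoly 2 K) :
  (forall i, 0 < p i) -> whomog p 1 f -> whomog p e g -> ~ smooth_curve g ->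
  (jac f g)@_0%MM = 0.
Proof.
move=> p_gt0 Hf Hg /existsNP[x /not_implyP[_ /forallNP gx]].
have HJ := whomog_jac Hf Hg.
have [j0|j0|j0] := ltgtP (1 + e - (p ord0 + p ord_max)) 0.
- by rewrite (whomog_lt0 p_gt0 j0 HJ) mcoeff0.
- exact: whomog_gt0_coeff0 j0 HJ.
rewrite j0 in HJ.
have d0 i : (g^`M(i)).@[x] = 0 by have /negP/negPn/eqP := gx i.
rewrite -(mevalC x (jac f g)@_0%MM) -(whomog_deg0 p_gt0 HJ).
by rewrite mevalB !mevalM !d0 !mulr0 subrr.
Qed.

Theorem theorem4p9 (R : realType) (p : 'I_2 -> rat) (e : rat)
    (f g : mpoly 2 R[i]) (d : nat) (N : 'I_(d - 1) -> nat)
    (h : 'I_(d - 1) -> mpoly 2 R[i])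
    (p_gt0 : forall i, 0 < p i)
    (g_homog : whomog p e g)
    (C0_reduced : reduced_curve g)
    (C0_singular : ~ smooth_curve g)
    (f_homog : whomog p 1 f)
    (f_nonconstant : nonconstant_on_branches f g)
    (d_dim : dim_quot (ideal2 f g) d)
    (h_jordan : jordan_basis p f g N h)
    (t : R[i]) (lam : rat)
    (V : rat -> set (gm_fibre f g t))
    (V_MK : malgrange_kashiwara (gmf_tau f g t 1) (gmf_dtau f g t) V) :
  let G := brieskorn_fibre f g t in
  let tauVG := gmf_tau f g t (- 1) @` G in
  basis_mod (gr_num V G lam) (gr_den V G tauVG lam)
    [pred ij : {i : 'I_(d - 1) & 'I_(N i).+1}
      | lambda p e f (h (tag ij)) (tagged ij) == lam]
    (fun ij => gmf_class f g t (omega_tilde p e f g (h (tag ij)) (tagged ij))).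
Proof.
move=> G tauVG.
have [g_neq0 g_nonunit _] := C0_reduced.
have e_gt0 := whomog_nonunit_gt0 p_gt0 g_homog g_neq0 g_nonunit.
have fg_colength : fin_colength p f g.
  have [b [_ b_span _]] := d_dim.
  by apply: (spanned_fin_colength (e := b) f_homog g_homog) => y; exact: b_span.
have [h_homog gJ_basis _] := h_jordan.
have J_neq0 : jac f g != 0.
  apply: (fin_colength_neq0 p_gt0 _ g_nonunit).
  exact: (basis_fin_colength g_homog (whomog_jac f_homog g_homog) gJ_basis).
have J_const := singular_jac_const p_gt0 f_homog g_homog C0_singular.
have [hd Hh] := choice h_homog.
exact: (gr_basis_chains p_gt0 e_gt0 f_homog g_homog g_neq0 J_neq0 J_const fg_colength
  Hh h_jordan lam V_MK).
Qed.
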